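(* Let $X, X_1, X_2, \ldots$ be iid real random variables with $\mathbb{E}|X|<\infty$ and $\mathbb{E}X<0$, satisfying assumptions (A1), (A2), (A3) listed in the context, where $\alpha>1$ is the tail index in (A1). For $b\ge 0$ and $c\in\mathbb{R}$ let $\mathbb{Q}^{b,c}$ be the law of $\{S_n\}_{n\ge0}$ with $S_0=0$ induced by the Blanchet-Glynn transition kernel $\mathsf{Q}^{b,c}$ defined in the context, and let $\tau_b=\inf\{n\ge0:S_n>b\}$. For any sufficiently large $c$ the following hold: (i) If $\alpha>1$, then $\mathbb{Q}^{b,c}(\tau_b<\infty)=1$ for all $b\ge0$. (ii) If $\alpha\in(1,3/2)$, then $\mathbb{E}^{\mathbb{Q}^{b,c}}\tau_b=\infty$ for all $b\ge0$. (iii) If $\alpha>2$, then $\mathbb{E}^{\mathbb{Q}^{b,c}}\tau_b=O(b)$ as $b\to\infty$.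
   Context: Random walk: under $\mathbb{P}$, $S_0=0$ and $S_n=\sum_{i=1}^n X_i$ with $X_i$ iid copies of $X$; $\mathsf{P}(y,\mathrm{d}z)=\mathbb{P}(S_1\in \mathrm{d}z\,|\,S_0=y)$ is its transition kernel. Notation: $x^+=\max\{x,0\}$, $x^-=-\min\{x,0\}$; $f(t)\sim g(t)$ means $f(t)/g(t)\to 1$ as $t\to\infty$; $\mathbb{E}^{\mathbb{Q}}$ is expectation under $\mathbb{Q}$. Assumptions: (A1) The right tail is regularly varying with tail index $\alpha>1$: for all $u>0$, $\mathbb{P}(X>ut)\sim u^{-\alpha}\mathbb{P}(X>t)$ as $t\to\infty$ (in particular $\mathbb{P}(X>t)>0$ for all $t$). (A2) There exists a function $h$ with $h(t)\to\infty$, $h(t)=o(t)$ and $\int_{h(t)}^\infty \mathbb{P}(X^->s)\,\mathrm{d}s=o\big(t\,\mathbb{P}(X^+>t)\big)$ as $t\to\infty$. (A3) The distribution of $X$ has a continuous density $f$ which is regularly varying with tail index $\alpha+1$, i.e. $f(ut)\sim u^{-(\alpha+1)}f(t)$ as $t\to\infty$ for all $u>0$. Blanchet-Glynn kernel: for $x\in\mathbb{R}$ let $v(x)=\min\{1,\frac{1}{|\mathbb{E}X|}\int_{-x}^\infty \mathbb{P}(X>s)\,\mathrm{d}s\}$ and $w(x)=\mathbb{E}[v(x+X)]$. For $b\ge0$, $c\in\mathbb{R}$, $$\mathsf{Q}^{b,c}(y,\mathrm{d}z)=\mathsf{P}(y,\mathrm{d}z)\,\frac{v(z-b-c)}{w(y-b-c)},$$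 which is a probability transition kernel. *)

(* Defs.v *)
From HB Require Import structures.
From mathcomp Require Import all_boot all_order all_algebra.
From mathcomp Require Import all_classical all_reals all_analysis.

Set Implicit Arguments.
Unset Strict Implicit.
Unset Printing Implicit Defensive.

Import Order.TTheory GRing.Theory Num.Theory.
Import numFieldNormedType.Exports.

Local Open Scope classical_set_scope.
Local Open Scope ring_scope.

(* Lets the Landau notations be used at +oo. *)
Canonical pinfty_filter_on (R : numFieldType) :=
  FilterType (pinfty_nbhs R) (@proper_pinfty_nbhs R).

(* Asymptotic equivalence at +oo as convergence of the ratio; since x / 0 = 0,
   the limit 1 forces g to be eventually nonzero. *)
Definition asymp_equiv {R : realType} (f g : R -> R) : Prop :=
  f t / g t @[t --> +oo] --> (1 : R).

(* The index is that of the decay: g varies regularly with exponent - a. *)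
Definition regularly_varying_tail {R : realType} (g : R -> R) (a : R) : Prop :=
  forall u : R, 0 < u ->
    asymp_equiv (fun t => g (u * t)) (fun t => u `^ (- a) * g t).

Section increment.
Context {d : measure_display} {T : measurableType d} {R : realType}.
Variable P : probability T R.

Definition upper_tail (Y : T -> R) (t : R) : R := fine (P [set w | t < Y w]).

Definition right_tail_varies_regularly (X : T -> R) (alpha : R) : Prop :=
  regularly_varying_tail (upper_tail X) alpha.

Definition left_tail_negligible (X : T -> R) : Prop :=
  exists h : R -> R,
    [/\ h t @[t --> +oo] --> +oo,
        h =o_ (pinfty_nbhs R) id &
        (fun t => \int[lebesgue_measure]_(s in `[h t, +oo[) upper_tail X^\- s)
          =o_ (pinfty_nbhs R) (fun t => t * upper_tail X^\+ t)].

Definition has_density (X : T -> R) (f : R -> R) : Prop :=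
  (forall x, 0 <= f x) /\
  forall A : set R, measurable A ->
    P (X @^-1` A) = (\int[lebesgue_measure]_(x in A) (f x)%:E)%E.

Definition density_varies_regularly (X : T -> R) (alpha : R) : Prop :=
  exists f : R -> R,
    [/\ continuous f, has_density X f & regularly_varying_tail f (alpha + 1)].

Definition walk_kernel (X : T -> R) (y : R) : set R -> \bar R :=
  pushforward P (fun w => y + X w).

Definition bg_v (X : T -> R) (x : R) : R :=
  Num.min 1 (`|fine 'E_P[X]|^-1 *
             \int[lebesgue_measure]_(s in `[- x, +oo[) upper_tail X s).

Definition bg_w (X : T -> R) (x : R) : R :=
  fine 'E_P[fun w => bg_v X (x + X w)].

Definition bg_kernel (X : T -> R) (b c y : R) (A : set R) : \bar R :=
  (\int[walk_kernel X y]_(z in A)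
     (bg_v X (z - b - c) / bg_w X (y - b - c))%:E)%E.

End increment.

Section path.
Context {d : measure_display} {T : measurableType d} {R : realType}.

(* [g_sigma_preimage] of the first n + 1 coordinates is the sigma-algebra
   generated by S 0, ..., S n; the last clause thus says that K (S n, A) is a
   version of the conditional probability of S (n + 1) \in A given the past. *)
Definition markov_chain (Q : probability T R) (S : nat -> {mfun T >-> R})
    (x0 : R) (K : R -> set R -> \bar R) : Prop :=
  {ae Q, forall w, S 0%N w = x0} /\
  forall (n : nat) (E : set T) (A : set R),
    g_sigma_preimage (fun (i : 'I_n.+1) (w : T) => S i w) E -> measurable A ->
    Q (E `&` S n.+1 @^-1` A) = (\int[Q]_(w in E) K (S n w) A)%E.

(* The infimum of the empty set is +oo. *)
Definition hitting_time (S : nat -> T -> R) (b : R) (w : T) : \bar R :=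
  ereal_inf [set n%:R%:E | n in [set n : nat | b < S n w]].

End path.

(* Main.v *)
Require Import Defs.
From HB Require Import structures.
From mathcomp Require Import all_boot all_order all_algebra.
From mathcomp Require Import all_classical all_reals all_analysis.
From mathcomp Require Import measurable_realfun ring lra.
Set Implicit Arguments.
Unset Strict Implicit.
Unset Printing Implicit Defensive.
Import Order.TTheory GRing.Theory Num.Theory.
Import numFieldNormedType.Exports.
Local Open Scope classical_set_scope.
Local Open Scope ring_scope.

(* Write g x = v (- x) and follow the distance D = b + c - S: from D = x the
   kernel draws a jump z of the walk with the weight g (x - z) / E g (x - X).
   Jumps at most x / 2 see a ratio g (x - z) / g x close to 1 and push D up by
   mu = - E X on average; with probability about mu (alpha - 1) / x one jump
   exceeds x and ends the excursion.  Hence, as long as S <= b and c is large,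
   ln D is a supermartingale with negative drift for every alpha > 1, which
   forces tau < oo, and D itself has drift at most - e when alpha > 2, which
   bounds E tau by (b + c) / e.  When alpha < 3 / 2, (D - c)^+ = (b - S)^+ is a
   submartingale; its upward steps have bounded conditional means, so that
   E tau < oo would force E[(b - S_n)^+; tau > n] to vanish, although it is
   nondecreasing in n and positive at n = 1. *)

(** * Integration of affinely bounded functions *)

(** Drift bounds are cleared of the normalising constant: the kernel mean of [F] is at most [H] iff
    [F - H], integrated against [g (x - z)], is at most 0. Only the distance [x = b + c - y] enters,
    so one threshold for [x] serves every [b], and a [c] beyond it keeps the whole excursion in the
    asymptotic regime. There [mu * g x] is the integrated tail [I x], so for [D] the contest is
    between the gain [I x] from small jumps and the loss [x * Fb x] from the ending jump. Karamata's
    ratio [x * Fb x / I x -> alpha - 1] decides: the loss wins for [alpha > 2], the gain for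
    [alpha < 3 / 2]. For [ln D] the comparison, multiplied by [x], is between [I x] and
    [x * ln x * Fb x], and the loss always wins. Regular variation is given scale by scale, so
    Karamata's limit is replaced by inequalities at a single scale [l]: [l = 2] where orders of
    magnitude or the bound [3 / 2] suffice, [l] close to 1 where only [alpha > 2] is known. *)

Section law.
Context {R : realType} (nu : probability R R).
Hypothesis nu_int : nu.-integrable setT (EFin \o @idfun R).

(** A class closed under the operations that build the integrands below; with a finite first moment,
    integrability becomes the syntactic check done by [affine_tac]. *)
Definition affine_bounded (F : R -> R) : Prop :=
  measurable_fun setT F /\ exists a : R, forall x, `|F x| <= a * (1 + `|x|).

Local Notation E F := (\int[nu]_x F x).

Lemma integrable_affine_bounded F : affine_bounded F ->
  nu.-integrable setT (EFin \o F).
Proof.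
move=> [mF [a Fa]].
have i1 : nu.-integrable setT (EFin \o (fun x : R => a * (1 + `|x|))).
  have -> : EFin \o (fun x : R => a * (1 + `|x|)) =
      (fun x => a%:E * ((cst 1%E \+ (abse \o (EFin \o idfun)))%E x))%E.
    by apply/funext => x /=.
  apply: integrableZl => //; apply: integrableD => //.
    exact: finite_measure_integrable_cst.
  exact: integrable_abse.
apply: le_integrable i1 => //; first exact/measurable_EFinP.
by move=> x _ /=; rewrite lee_fin (le_trans (Fa x))// ler_norm.
Qed.

Lemma mean_le F G : affine_bounded F -> affine_bounded G ->
  (forall x, F x <= G x) -> E F <= E G.
Proof.
by move=> aF aG FG; apply: le_Rintegral => //; exact: integrable_affine_bounded.
Qed.

Lemma meanD F G : affine_bounded F -> affine_bounded G ->
  \int[nu]_x (F x + G x) = E F + E G.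
Proof. by move=> aF aG; apply: RintegralD => //; exact: integrable_affine_bounded. Qed.

Lemma meanB F G : affine_bounded F -> affine_bounded G ->
  \int[nu]_x (F x - G x) = E F - E G.
Proof. by move=> aF aG; apply: RintegralB => //; exact: integrable_affine_bounded. Qed.

Lemma meanZ k F : affine_bounded F -> \int[nu]_x (k * F x) = k * E F.
Proof. by move=> aF; apply: RintegralZl => //; exact: integrable_affine_bounded. Qed.

Lemma mean_cst k : \int[nu]_x k = k.
Proof.
rewrite Rintegral_cst// (_ : fine _ = fine 1%E) ?mulr1//.
by congr fine; exact: probability_setT.
Qed.

Lemma affine_bounded_cst k : affine_bounded (fun=> k).
Proof.
split; first exact: measurable_cst.
exists `|k| => x; rewrite ler_peMr//; have := normr_ge0 x; lra.
Qed.

Lemma affine_bounded_id : affine_bounded (fun x => x).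
Proof. split; first exact: measurable_id. by exists 1 => x; lra. Qed.

Lemma affine_boundedD F G : affine_bounded F -> affine_bounded G ->
  affine_bounded (fun x => F x + G x).
Proof.
move=> [mF [a Fa]] [mG [b Gb]]; split; first exact: measurable_funD.
exists (a + b) => x; rewrite (le_trans (ler_normD _ _))// mulrDl lerD//.
Qed.

Lemma affine_boundedZ k F : affine_bounded F -> affine_bounded (fun x => k * F x).
Proof.
move=> [mF [a Fa]]; split; first exact: measurable_funM.
by exists (`|k| * a) => x; rewrite normrM -mulrA ler_wpM2l.
Qed.

Lemma affine_boundedN F : affine_bounded F -> affine_bounded (fun x => - F x).
Proof.
move=> [mF [a Fa]]; split; first exact: measurable_funN.
by exists a => x; rewrite normrN.
Qed.

Lemma affine_boundedB F G : affine_bounded F -> affine_bounded G ->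
  affine_bounded (fun x => F x - G x).
Proof. by move=> aF aG; apply: affine_boundedD => //; exact: affine_boundedN. Qed.

Lemma affine_bounded_normr F : affine_bounded F -> affine_bounded (fun x => `|F x|).
Proof.
move=> [mF [a Fa]]; split; first exact: measurableT_comp.
by exists a => x; rewrite normr_id.
Qed.

Lemma affine_bounded_maxr F G : affine_bounded F -> affine_bounded G ->
  affine_bounded (fun x => Num.max (F x) (G x)).
Proof.
move=> [mF [a Fa]] [mG [b Gb]]; split; first exact: measurable_maxr.
exists (a + b) => x; have := Fa x; have := Gb x.
have := le_trans (normr_ge0 _) (Fa x); have := le_trans (normr_ge0 _) (Gb x).
by rewrite mulrDl; case: (leP (F x) (G x)) => _; lra.
Qed.

Lemma affine_bounded_minr F G : affine_bounded F -> affine_bounded G ->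
  affine_bounded (fun x => Num.min (F x) (G x)).
Proof.
move=> [mF [a Fa]] [mG [b Gb]]; split; first exact: measurable_minr.
exists (a + b) => x; have := Fa x; have := Gb x.
have := le_trans (normr_ge0 _) (Fa x); have := le_trans (normr_ge0 _) (Gb x).
by rewrite mulrDl; case: (leP (F x) (G x)) => _; lra.
Qed.

Lemma affine_boundedM (F G : R -> R) : affine_bounded F ->
  measurable_fun setT G -> (forall x, `|G x| <= 1) ->
  affine_bounded (fun x => F x * G x).
Proof.
move=> [mF [a Fa]] mG G1; split; first exact: measurable_funM.
exists a => x; rewrite normrM (le_trans _ (Fa x))// ler_piMr//.
Qed.

Lemma measurable_bool_nat (p : R -> bool) : measurable_fun setT p ->
  measurable_fun setT (fun x => (p x)%:R : R).
Proof.
move=> mp; have -> : (fun x => (p x)%:R : R) = (fun x => if p x then 1 else 0).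
  by apply/funext => x; case: (p x).
by apply: measurable_fun_ifT => //; exact: measurable_cst.
Qed.

Lemma affine_bounded_bool (p : R -> bool) : measurable_fun setT p ->
  affine_bounded (fun x => (p x)%:R : R).
Proof.
move=> mp; split; first exact: measurable_bool_nat.
by exists 1 => x; have := normr_ge0 x; case: (p x); rewrite ?normr1 ?normr0; lra.
Qed.

Lemma affine_boundedMb (F : R -> R) (p : R -> bool) : affine_bounded F ->
  measurable_fun setT p -> affine_bounded (fun x => F x * (p x)%:R).
Proof.
move=> aF mp; apply: affine_boundedM => //; first exact: measurable_bool_nat.
by move=> x; case: (p x); rewrite ?normr1 ?normr0.
Qed.

(** Tonelli for the indicator of [t <= s < psi x], whose integral in [s] is the length of [[t, psi
    x[]. A general [psi] also covers rescaled jumps, see [excess_scale]. *)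
Lemma layer_cake (psi : R -> R) (t : R) : affine_bounded psi ->
  (\int[nu]_x Num.max (psi x - t) 0)%:E =
  (\int[lebesgue_measure]_(s in `[t, +oo[) (\int[nu]_x (s < psi x)%R%:R)%:E)%E.
Proof.
move=> apsi.
have mp : measurable_fun setT psi by case: apsi.
pose f (p : R * R) : \bar R := ((t <= p.2)%R && (p.2 < psi p.1)%R)%:R%:E.
have mf : measurable_fun setT f.
  apply/measurable_EFinP.
  have -> : (fun p : R * R => ((t <= p.2)%R && (p.2 < psi p.1)%R)%:R : R) =
    (fun p => if (t <= p.2)%R && (p.2 < psi p.1)%R then 1 else 0).
    by apply/funext => p; case: (_ && _).
  apply: measurable_fun_ifT; [|exact: measurable_cst..].
  apply: measurable_and.
    by apply: measurable_fun_ler; [exact: measurable_cst|exact: measurable_snd].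
  apply: measurable_fun_ltr; [exact: measurable_snd|].
  by apply: measurableT_comp => //; exact: measurable_fst.
rewrite /Rintegral fineK; last first.
  apply: integrable_fin_num => //; apply: integrable_affine_bounded.
  apply: affine_bounded_maxr; last exact: affine_bounded_cst.
  by apply: affine_boundedB => //; exact: affine_bounded_cst.
transitivity (\int[nu]_x \int[lebesgue_measure]_s f (x, s))%E.
  apply: eq_integral => x _.
  have -> : (fun s => f (x, s)) = (fun s => (\1_(`[t, psi x[) s)%:E).
    apply/funext => s; rewrite /f indicE/= mem_setE in_itv/=; by case: (_ && _).
  rewrite integral_indic//= setIT lebesgue_measure_itv/= lte_fin.
  case: ltP => tp.
    by rewrite -EFinB; congr EFin; apply/max_idPl; rewrite subr_ge0 ltW.
  by congr EFin; apply/max_idPr; rewrite subr_le0.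
transitivity (\int[lebesgue_measure]_s \int[nu]_x f (x, s))%E.
  by apply: fubini_tonelli => // p; rewrite lee_fin ler0n.
rewrite [RHS]integral_mkcond; apply: eq_integral => s _.
rewrite patchE mem_setE in_itv/= andbT; case: (leP t s) => ts.
  rewrite fineK.
    by apply: eq_integral => x _; rewrite /f/= ts.
  apply: integrable_fin_num => //; apply: integrable_affine_bounded.
  apply: affine_bounded_bool; apply: measurable_fun_ltr => //; exact: measurable_cst.
by apply: integral0_eq => x _; rewrite /f/= leNgt ts.
Qed.

End law.

Ltac meas_tac := repeat first
  [ exact: measurable_cst | exact: measurable_id | exact: normr_measurable
  | apply: measurable_fun_ltr | apply: measurable_fun_ler
  | apply: measurable_and | apply: measurable_funB | apply: measurable_funD
  | apply: measurable_funM ].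

Ltac affine_tac := repeat first
  [ exact: affine_bounded_id | exact: affine_bounded_cst
  | apply: affine_boundedMb | apply: affine_bounded_bool
  | apply: affine_boundedB | apply: affine_boundedD | apply: affine_boundedN
  | apply: affine_boundedZ | apply: affine_bounded_normr
  | apply: affine_bounded_maxr | apply: affine_bounded_minr ]; meas_tac.

(** * Tail, integrated tail and truncated first moment *)

Section tail.
Context {R : realType} (nu : probability R R).
Hypothesis nu_int : nu.-integrable setT (EFin \o @idfun R).

Definition tail (t : R) : R := \int[nu]_x (t < x)%R%:R.

(** The integrated tail, by [excess_integral]; as a mean it can be estimated pointwise under the
    integral. *)
Definition excess (t : R) : R := \int[nu]_x Num.max (x - t) 0.

Definition tail_moment (K : R) : R := \int[nu]_x (`|x| * (K < `|x|)%R%:R).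

Lemma tail_ge0 t : 0 <= tail t.
Proof. by apply: Rintegral_ge0 => x _; rewrite ler0n. Qed.

Lemma tail_le s t : s <= t -> tail t <= tail s.
Proof.
move=> st; apply: mean_le => //; [affine_tac..|] => x.
by rewrite ler_nat; case: ltP => // tx; rewrite (le_lt_trans st tx).
Qed.

Lemma excess_le s t : s <= t -> excess t <= excess s.
Proof.
move=> st; apply: mean_le => //; [affine_tac..|] => x.
by rewrite ge_max !le_max lexx orbT lerB.
Qed.

Lemma excess_lb t : \int[nu]_x x - t <= excess t.
Proof.
rewrite -{1}(mean_cst nu t) -meanB//; [|affine_tac..].
by apply: mean_le => //; [affine_tac..|] => x; rewrite le_max lexx.
Qed.

Lemma excess_tail_moment t : 0 <= t -> excess t <= tail_moment t.
Proof.
move=> t0; apply: mean_le => //; [affine_tac..|] => x.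
case: (ltP t `|x|) => tx; rewrite ?mulr1 ?mulr0 ge_max.
  by rewrite normr_ge0 andbT lerBlDr; have := ler_norm x; lra.
by rewrite lexx andbT; have := ler_norm x; lra.
Qed.

(** The positive part is 1-Lipschitz, and both integrands vanish for [z <= x / 2], because
    [x - y >= x / 2]. *)
Lemma excess_dist (x y : R) : 0 <= x -> `|y| <= x / 2 ->
  `|excess (x - y) - excess x| <= `|y| * tail (x / 2).
Proof.
move=> x0 yx; rewrite -meanB//; [|affine_tac..].
apply: le_trans (le_normr_Rintegral _ _) _ => //.
  by apply: integrable_affine_bounded => //; affine_tac.
rewrite -meanZ//; last by affine_tac.
apply: mean_le => //; [affine_tac..|] => z.
move: yx; rewrite ler_norml => /andP[y1 y2].
have := ler_norm y; have := ler_norm (- y); rewrite normrN => n1 n2.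
case: (ltP (x / 2) z) => xz; rewrite ?mulr1 ?mulr0.
  rewrite ler_norml; case: (leP (z - (x - y)) 0) => h1; case: (leP (z - x) 0) => h2.
  - by apply/andP; split; lra.
  - by apply/andP; split; lra.
  - by apply/andP; split; lra.
  - by apply/andP; split; lra.
rewrite (max_r (_ : z - (x - y) <= 0)); last by lra.
by rewrite (max_r (_ : z - x <= 0)) ?subrr ?normr0//; lra.
Qed.

(** The difference is the integral of the tail over [[x, l * x]], here bounded by length times the
    value at the left end, and in [excess_sub_ge] from below by the value at the right end. *)
Lemma excess_sub_le (l x : R) : 1 <= l -> 0 <= x ->
  excess x - excess (l * x) <= (l - 1) * x * tail x.
Proof.
move=> l1 x0; rewrite -meanB//; [|affine_tac..].
rewrite -meanZ//; last by affine_tac.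
apply: mean_le => //; [affine_tac..|] => z.
have lx : x <= l * x by nra.
case: (ltP x z) => xz; rewrite ?mulr1 ?mulr0.
  by case: (leP (z - l * x) 0) => h1; case: (leP (z - x) 0) => h2; nra.
rewrite (max_r (_ : z - x <= 0)); last by lra.
by rewrite (max_r (_ : z - l * x <= 0)) ?subrr//; lra.
Qed.

Lemma excess_sub_ge (l x : R) : 1 <= l -> 0 <= x ->
  (l - 1) * x * tail (l * x) <= excess x - excess (l * x).
Proof.
move=> l1 x0; rewrite -meanB//; [|affine_tac..].
rewrite -meanZ//; last by affine_tac.
apply: mean_le => //; [affine_tac..|] => z.
have lx : x <= l * x by nra.
case: (ltP (l * x) z) => xz; rewrite ?mulr1 ?mulr0.
  rewrite (max_l (_ : 0 <= z - x)); last by lra.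
  by rewrite (max_l (_ : 0 <= z - l * x)); lra.
rewrite (max_r (_ : z - l * x <= 0)); last by lra.
by rewrite subr0 le_max lexx orbT.
Qed.

Let measurable_tail : measurable_fun setT tail.
Proof.
have -> : tail = (fun t => - (- tail t)) by apply/funext => t; rewrite opprK.
apply: measurableT_comp => //; apply: nondecreasing_measurable => // s t st.
by rewrite lerN2 tail_le.
Qed.

Lemma excess_integral (t : R) :
  (excess t)%:E = (\int[lebesgue_measure]_(s in `[t, +oo[) (tail s)%:E)%E.
Proof.
have h := layer_cake nu_int t affine_bounded_id.
etransitivity; first exact: h.
by apply: eq_integral => s _; congr EFin.
Qed.

(** The substitution [s -> l * s] in the integrated tail, obtained by rescaling the jump instead of
    the Lebesgue variable. *)
Let excess_scale (l t : R) : 0 < l ->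
  (excess (l * t))%:E =
  (l%:E * \int[lebesgue_measure]_(s in `[t, +oo[) (tail (l * s))%:E)%E.
Proof.
move=> l0.
have -> : excess (l * t) = l * \int[nu]_x Num.max (l^-1 * x - t) 0.
  rewrite -meanZ//; last by affine_tac.
  apply: eq_Rintegral => x _; rewrite maxr_pMr ?ltW// mulr0.
  by rewrite mulrBr mulrA mulfV ?gt_eqF// mul1r.
have -> := EFinM l (\int[nu]_x Num.max (l^-1 * x - t) 0); congr (_ * _)%E.
etransitivity.
  exact: (layer_cake nu_int t (affine_boundedZ l^-1 affine_bounded_id)).
apply: eq_integral => s _; congr EFin.
by apply: eq_Rintegral => x _; rewrite ltr_pdivlMl.
Qed.

Lemma excess_scale_le (l q x : R) : 0 < l -> 0 <= q ->
  (forall s, x <= s -> tail (l * s) <= q * tail s) ->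
  excess (l * x) <= l * q * excess x.
Proof.
move=> l0 q0 lq; rewrite -lee_fin excess_scale// -mulrA EFinM.
apply: lee_wpmul2l; first by rewrite lee_fin ltW.
rewrite EFinM excess_integral -ge0_integralZl_EFin//; last first.
- by apply/measurable_EFinP; exact: measurable_funTS.
- by move=> s _; rewrite lee_fin tail_ge0.
apply: ge0_le_integral => //=.
- by move=> s _; rewrite lee_fin tail_ge0.
- apply/measurable_EFinP/measurable_funTS.
  by apply: measurableT_comp => //; meas_tac.
- by apply: measurable_funeM; apply/measurable_EFinP; exact: measurable_funTS.
- by move=> s; rewrite in_itv/= andbT => xs; rewrite lee_fin lq.
Qed.

Lemma excess_scale_ge (l q x : R) : 0 < l -> 0 <= q ->
  (forall s, x <= s -> q * tail s <= tail (l * s)) ->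
  l * q * excess x <= excess (l * x).
Proof.
move=> l0 q0 lq; rewrite -lee_fin excess_scale// -mulrA EFinM.
apply: lee_wpmul2l; first by rewrite lee_fin ltW.
rewrite EFinM excess_integral -ge0_integralZl_EFin//; last first.
- by apply/measurable_EFinP; exact: measurable_funTS.
- by move=> s _; rewrite lee_fin tail_ge0.
apply: ge0_le_integral => //=.
- by move=> s _; rewrite mule_ge0// lee_fin// tail_ge0.
- by apply: measurable_funeM; apply/measurable_EFinP; exact: measurable_funTS.
- apply/measurable_EFinP/measurable_funTS.
  by apply: measurableT_comp => //; meas_tac.
- by move=> s; rewrite in_itv/= andbT => xs; rewrite lee_fin lq.
Qed.

(** Dominated convergence along integer levels, then monotonicity in [K]. It controls both the
    excess far out and the jumps beyond a fixed truncation level. *)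
Lemma tail_moment_small (e : R) : 0 < e ->
  exists2 K0 : R, 0 < K0 & forall K, K0 <= K -> tail_moment K <= e.
Proof.
move=> e0.
have := @dominated_convergence _ _ R nu setT measurableT
  (fun (n : nat) x => (`|x| * (n%:R < `|x|)%R%:R)%:E) (cst 0%E) (fun x => `|x|%:E).
case=> //.
- move=> n; apply/measurable_EFinP.
  by apply: measurable_funM; [meas_tac|apply: measurable_bool_nat; meas_tac].
- apply: aeW => x _; apply: cvg_near_cst; near=> n.
  rewrite /= ltNge (_ : `|x| <= n%:R) ?mulr0//.
  near: n; exact: nbhs_infty_ger.
- exact: (integrable_abse nu_int).
- apply: aeW => x n _; rewrite /= lee_fin ger0_norm ?mulr_ge0//.
  by rewrite ler_piMr//; case: (_ < _).
move=> [_ _].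
rewrite integral0 => /fine_cvgP[_] h.
have [N _ hN] := cvgr_lt _ h _ e0.
exists N.+1%:R; first by rewrite ltr0n.
move=> K NK; apply: le_trans (ltW (hN N (leqnn N))).
apply: mean_le => //; [affine_tac..|] => x.
rewrite ler_wpM2l// ler_nat; case: (ltP K `|x|) => // Kx.
rewrite (_ : N%:R < `|x|)//; apply: le_lt_trans Kx.
by apply: le_trans NK; rewrite ler_nat.
Unshelve. all: by end_near. Qed.

End tail.

(** * Regular variation of the tail *)

Section regular_variation.
Context {R : realType} (nu : probability R R).
Hypothesis nu_int : nu.-integrable setT (EFin \o @idfun R).
Variable alpha : R.
Hypothesis alpha_gt1 : 1 < alpha.
Hypothesis tail_rv : regularly_varying_tail (tail nu) alpha.

Local Notation Fb := (tail nu).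
Local Notation I := (excess nu).

(** At scale 1 the ratio of the tail to itself tends to 1, while it would be 0 wherever the tail
    vanishes, since [0^-1 = 0]; monotonicity carries positivity back to every [t]. *)
Lemma tail_gt0 t : 0 < Fb t.
Proof.
have h := tail_rv ltr01; rewrite /asymp_equiv in h.
have : \forall t \near +oo, 0 < Fb t.
  near=> s; rewrite lt_neqAle tail_ge0 andbT eq_sym.
  have : 0 < Fb (1 * s) / (1 `^ (- alpha) * Fb s).
    by near: s; exact: cvgr_gt _ h _ ltr01.
  by apply: contraTneq => ->; rewrite mulr0 invr0 mulr0 ltxx.
move=> /filterI/(_ (nbhs_pinfty_ge (num_real t))) /filter_ex[s [s0 ts]].
by rewrite (lt_le_trans s0)// tail_le.
Unshelve. all: by end_near. Qed.

Lemma tail_scale_le (l q : R) : 0 < l -> l `^ (- alpha) < q ->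
  \forall t \near +oo, Fb (l * t) <= q * Fb t.
Proof.
move=> l0 lq; have h := tail_rv l0; rewrite /asymp_equiv in h.
have p0 : 0 < l `^ (- alpha) by exact: powR_gt0.
near=> t.
have : Fb (l * t) / (l `^ (- alpha) * Fb t) < q / l `^ (- alpha).
  by near: t; apply: cvgr_lt _ h _ _; rewrite ltr_pdivlMr// mul1r.
rewrite ltr_pdivrMr ?mulr_gt0 ?tail_gt0// => /ltW/le_trans; apply.
by rewrite mulrA divfK// gt_eqF.
Unshelve. all: by end_near. Qed.

Lemma tail_scale_ge (l q : R) : 0 < l -> q < l `^ (- alpha) ->
  \forall t \near +oo, q * Fb t <= Fb (l * t).
Proof.
move=> l0 lq; have h := tail_rv l0; rewrite /asymp_equiv in h.
have p0 : 0 < l `^ (- alpha) by exact: powR_gt0.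
near=> t.
have : q / l `^ (- alpha) < Fb (l * t) / (l `^ (- alpha) * Fb t).
  by near: t; apply: cvgr_gt _ h _ _; rewrite ltr_pdivrMr// mul1r.
rewrite ltr_pdivlMr ?mulr_gt0 ?tail_gt0// => /ltW; apply: le_trans.
by rewrite mulrA divfK// gt_eqF.
Unshelve. all: by end_near. Qed.

Lemma near_pinfty_forall (p : R -> Prop) : (\forall t \near +oo, p t) ->
  \forall t \near +oo, forall s, t <= s -> p s.
Proof.
move=> [M [Mr hM]]; exists M; split => // t Mt s ts; apply: hM.
exact: lt_le_trans ts.
Qed.

Lemma near_pinfty_scale (p : R -> Prop) (k : R) : 0 < k ->
  (\forall t \near +oo, p t) -> \forall t \near +oo, p (k * t).
Proof.
move=> k0 [M [Mr hM]]; exists (M / k); split; first exact: num_real.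
by move=> t; rewrite ltr_pdivrMr// mulrC => Mt; exact: hM.
Qed.

(* Karamata's theorem with explicit constants: the excess over l x is at most
   l q times, and at least l q' times, the excess over x. *)
Lemma excess_le_tail (l q : R) : 1 < l -> l `^ (- alpha) < q ->
  \forall x \near +oo, (1 - l * q) * I x <= (l - 1) * x * Fb x.
Proof.
move=> l1 lq; have l0 : 0 < l by rewrite (lt_trans _ l1).
have q0 : 0 <= q by rewrite (le_trans (powR_ge0 _ _) (ltW lq)).
near=> x.
have x0 : 0 <= x by near: x; exact: nbhs_pinfty_ge.
have h1 : I (l * x) <= l * q * I x.
  apply: excess_scale_le => //.
  by near: x; apply: near_pinfty_forall; exact: tail_scale_le.
by have := excess_sub_le nu_int (ltW l1) x0; lra.
Unshelve. all: by end_near. Qed.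

Lemma tail_le_excess (l q : R) : 1 < l -> 0 <= q -> q < l `^ (- alpha) ->
  \forall x \near +oo, (l - 1) * q * (x * Fb x) <= (1 - l * q) * I x.
Proof.
move=> l1 q0 lq; have l0 : 0 < l by rewrite (lt_trans _ l1).
near=> x.
have x0 : 0 <= x by near: x; exact: nbhs_pinfty_ge.
have h : forall s, x <= s -> q * Fb s <= Fb (l * s).
  by near: x; apply: near_pinfty_forall; exact: tail_scale_ge.
have h1 : l * q * I x <= I (l * x) by exact: excess_scale_ge.
have h2 : (l - 1) * x * (q * Fb x) <= (l - 1) * x * Fb (l * x).
  by rewrite ler_wpM2l ?h// mulr_ge0// subr_ge0 ltW.
by have := excess_sub_ge nu_int (ltW l1) x0; lra.
Unshelve. all: by end_near. Qed.

Lemma gt0_powRE (l x : R) : 0 < l -> l `^ x = expR (x * ln l).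
Proof. by move=> l0; rewrite /powR gt_eqF. Qed.

(** Leaves room at scale [l = 2] for a [q] with [1 - 2 * q > 0], the factor of the excess in
    [excess_le_tail]. *)
Lemma powR2N_lt : 2 `^ (- alpha) < (2^-1 : R).
Proof.
rewrite gt0_powRE// -[ltRHS]lnK ?posrE ?invr_gt0// ltr_expR lnV ?posrE//.
have : 0 < ln 2 :> R by rewrite ln_gt0// ltr1n.
by have := alpha_gt1; nra.
Qed.

Lemma tail_excess_le : exists2 C : R, 0 < C &
  \forall x \near +oo, x * Fb x <= C * I x.
Proof.
have p0 : 0 < 2 `^ (- alpha) :> R by exact: powR_gt0.
have p1 := powR2N_lt; set q := 2 `^ (- alpha) / 2.
have q0 : 0 < q by rewrite divr_gt0.
have qlt : q < 2 `^ (- alpha) by rewrite /q; lra.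
exists ((1 - 2 * q) / q); first by rewrite divr_gt0//; lra.
near=> x.
have : (2 - 1) * q * (x * Fb x) <= (1 - 2 * q) * I x.
  by near: x; apply: tail_le_excess => //; [rewrite ltr1n|exact: ltW].
by rewrite [_ / q * _]mulrAC ler_pdivlMr// => h; lra.
Unshelve. all: by end_near. Qed.

Lemma excess_tail_le : exists2 C : R, 0 < C &
  \forall x \near +oo, I x <= C * (x * Fb x).
Proof.
(* The midpoint: above the limiting ratio, as [excess_le_tail] asks, and below [1 / 2]. *)
have p1 := powR2N_lt; set q := (2 `^ (- alpha) + 2^-1) / 2.
have [q1 q2] : 2 `^ (- alpha) < q /\ q < 2^-1 by rewrite /q; split; lra.
exists (1 - 2 * q)^-1; first by rewrite invr_gt0; lra.
near=> x.
have : (1 - 2 * q) * I x <= (2 - 1) * x * Fb x.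
  by near: x; apply: excess_le_tail => //; rewrite ltr1n.
rewrite ler_pdivlMl; first by lra.
by lra.
Unshelve. all: by end_near. Qed.

Lemma tail_half_le : exists2 C : R, 0 < C &
  \forall x \near +oo, Fb (x / 2) <= C * Fb x.
Proof.
exists (2^-1 `^ (- alpha) + 1); first by rewrite ltr_pwDr// powR_ge0.
near=> x; rewrite mulrC; near: x; apply: tail_scale_le; first by rewrite invr_gt0.
by rewrite ltrDl.
Unshelve. all: by end_near. Qed.

(** Passes to [x * Fb x], where halving the argument is covered by regular variation, and back. *)
Lemma excess_half_le : exists2 C : R, 0 < C &
  \forall x \near +oo, I (x / 2) <= C * I x.
Proof.
have [C1 C10 h1] := excess_tail_le; have [C2 C20 h2] := tail_half_le.
have [C3 C30 h3] := tail_excess_le.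
exists (C1 * C2 * C3); first by rewrite !mulr_gt0.
near=> x.
have x0 : 0 <= x by near: x; exact: nbhs_pinfty_ge.
have e1 : I (x / 2) <= C1 * (x / 2 * Fb (x / 2)).
  rewrite [x / 2]mulrC; near: x.
  by apply: (@near_pinfty_scale (fun y => I y <= C1 * (y * Fb y))); rewrite ?invr_gt0.
have e2 : Fb (x / 2) <= C2 * Fb x by near: x.
have e3 : x * Fb x <= C3 * I x by near: x.
have h : x / 2 * Fb (x / 2) <= C2 * (C3 * I x).
  have e4 := tail_ge0 nu (x / 2).
  have e5 := mulr_ge0 x0 e4; have e6 := ler_wpM2l x0 e2.
  by have e7 := ler_wpM2l (ltW C20) e3; lra.
by have := ler_wpM2l (ltW C10) h; lra.
Unshelve. all: by end_near. Qed.

(** The Lipschitz constant [Fb (x / 2)] of [excess_dist] is of order [I x / x], so a jump [y]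
    changes the excess by a relative amount of order [y / x]. *)
Lemma excess_slow : exists2 C : R, 0 < C & \forall x \near +oo,
  forall y, `|y| <= x / 2 -> `|I (x - y) - I x| <= C * `|y| / x * I x.
Proof.
have [C2 C20 h2] := tail_half_le; have [C3 C30 h3] := tail_excess_le.
exists (C2 * C3); first by rewrite !mulr_gt0.
near=> x => y yx.
have x0 : 0 < x by near: x; exact: nbhs_pinfty_gt.
have e2 : Fb (x / 2) <= C2 * Fb x by near: x.
have e3 : x * Fb x <= C3 * I x by near: x.
apply: (le_trans (excess_dist nu_int (ltW x0) yx)).
rewrite [_ / x * _]mulrAC ler_pdivlMr//.
have h : Fb (x / 2) * x <= C2 * (C3 * I x).
  have e6 := ler_wpM2l (ltW x0) e2.
  by have e7 := ler_wpM2l (ltW C20) e3; lra.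
by have := ler_wpM2l (normr_ge0 y) h; lra.
Unshelve. all: by end_near. Qed.

Lemma excess_near_le (e : R) : 0 < e -> \forall x \near +oo, I x <= e.
Proof.
move=> e0; have [K K0 hK] := tail_moment_small nu_int e0.
near=> x; have Kx : K <= x by near: x; apply: nbhs_pinfty_ge; exact: num_real.
by apply: le_trans (hK _ Kx); apply: excess_tail_moment => //;
  apply: le_trans Kx; exact: ltW.
Unshelve. all: by end_near. Qed.

Lemma excess_gt0 t : 0 < I t.
Proof.
have t1 : t < t + 1 by lra.
have : \int[nu]_x (1 * (t + 1 < x)%R%:R) <= I t.
  apply: mean_le => //; [affine_tac..|] => x.
  by case: ltP => tx; rewrite ?mulr1 ?mulr0 le_max ?lexx ?orbT//; apply/orP; left; lra.
by rewrite meanZ// ?mul1r; [apply: lt_le_trans; exact: tail_gt0|affine_tac].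
Qed.

End regular_variation.

(** * Drift of the tilted walk *)

Section weight.
Context {R : realType} (nu : probability R R).
Hypothesis nu_int : nu.-integrable setT (EFin \o @idfun R).
Variable alpha : R.
Hypothesis alpha_gt1 : 1 < alpha.
Hypothesis tail_rv : regularly_varying_tail (tail nu) alpha.
Variable mu : R.
Hypothesis mu_gt0 : 0 < mu.
Hypothesis mean_mu : \int[nu]_x x = - mu.

Local Notation Fb := (tail nu).
Local Notation I := (excess nu).

Definition weight (x : R) : R := Num.min 1 (mu^-1 * excess nu x).

Local Notation g := weight.

Lemma weight_gt0 x : 0 < g x.
Proof.
by rewrite lt_min ltr01 mulr_gt0 ?invr_gt0//; exact: (excess_gt0 nu_int tail_rv).
Qed.

Lemma weight_le1 x : g x <= 1.
Proof. by rewrite ge_min lexx. Qed.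

Lemma weight_le x y : x <= y -> g y <= g x.
Proof.
move=> xy; rewrite le_min weight_le1/= ge_min ler_wpM2l ?orbT ?invr_ge0 ?(ltW mu_gt0)//.
exact: excess_le.
Qed.

Lemma weight_ub x : g x <= mu^-1 * I x.
Proof. by rewrite ge_min lexx orbT. Qed.

(** The excess is at least [- mu - x], which reaches [mu] at [x = - 2 * mu]. This is the origin of
    the margin [2 * mu] in the drift lemmas. *)
Lemma weight_eq1 x : x <= - (2 * mu) -> g x = 1.
Proof.
move=> xmu; apply/min_idPl; rewrite ler_pdivlMl// mulr1.
by have := excess_lb nu_int x; rewrite mean_mu; lra.
Qed.

Lemma weight_near : \forall x \near +oo, g x = mu^-1 * I x.
Proof.
near=> x; apply/min_idPr; rewrite ler_pdivrMl// mulr1; near: x.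
exact: excess_near_le.
Unshelve. all: by end_near. Qed.

Lemma measurable_weight : measurable_fun setT g.
Proof.
have -> : g = (fun t => - (- g t)) by apply/funext => t; rewrite opprK.
apply: measurableT_comp => //; apply: nondecreasing_measurable => // s t st.
by rewrite lerN2 weight_le.
Qed.

Lemma measurable_weightB (x : R) : measurable_fun setT (fun z : R => g (x - z)).
Proof. by apply: measurableT_comp; [exact: measurable_weight|meas_tac]. Qed.

Lemma affine_bounded_weight (F : R -> R) (x : R) : affine_bounded F ->
  affine_bounded (fun z => F z * g (x - z)).
Proof.
move=> aF; apply: affine_boundedM => //; first exact: measurable_weightB.
by move=> z; rewrite ger0_norm ?weight_le1// ltW// weight_gt0.
Qed.

Lemma mean_weight_gt0 (x : R) : 0 < \int[nu]_z g (x - z).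
Proof.
apply: (@lt_le_trans _ _ (g x * Fb 0)).
  by rewrite mulr_gt0 ?weight_gt0//; exact: (tail_gt0 nu_int tail_rv).
rewrite -meanZ//; last by affine_tac.
have h := affine_bounded_weight x (affine_bounded_cst 1).
apply: mean_le => //; [affine_tac| |move=> z].
  by have -> : (fun z => g (x - z)) = (fun z => 1 * g (x - z));
    [apply/funext => z; rewrite mul1r|].
case: (ltP 0 z) => z0; rewrite ?mulr1 ?mulr0.
  by apply: weight_le; lra.
exact/ltW/weight_gt0.
Qed.

(** For [|z| <= K] the slow variation of the excess gives the first error term. For [|z| > K] one
    has [|e - z| <= 2 * |z|], and the truncation at [x / 2] keeps the weight below
    [g (x / 2) <= C' * g x]. Both errors carry the factor [g x]. *)
Let small_jump_dist (e C C' K x : R) : 0 <= e -> e <= K -> 0 < C -> 0 < C' ->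
  0 < x -> 2 * K <= x ->
  (forall s, x / 2 <= s -> g s = mu^-1 * I s) ->
  (forall y, `|y| <= x / 2 -> `|I (x - y) - I x| <= C * `|y| / x * I x) ->
  I (x / 2) <= C' * I x -> forall z,
  `|(e - z) * g (x - z) * (z <= x / 2)%R%:R - (e - z) * g x| <=
  g x * ((e + K) * C * K / x + 2 * (C' + 1) * (`|z| * (K < `|z|)%R%:R)).
Proof.
move=> e0 eK C0 C'0 x0 Kx gE slow half z.
have gx : g x = mu^-1 * I x by apply: gE; lra.
have gx0 := weight_gt0 x.
have z1 := ler_norm z; have z2 := ler_norm (- z); rewrite normrN in z2.
have z0 := normr_ge0 z.
have ez : `|e - z| <= e + `|z|.
  by rewrite (le_trans (ler_normB _ _))// (ger0_norm e0).
case: (ltP K `|z|) => Kz; rewrite ?mulr1 ?mulr0 ?addr0.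
  rewrite -mulrA -mulrBr normrM.
  have h : `|g (x - z) * (z <= x / 2)%R%:R - g x| <= (C' + 1) * g x.
    have hC : g (x - z) * (z <= x / 2)%R%:R <= C' * g x.
      case: (leP z (x / 2)) => zx; rewrite ?mulr1 ?mulr0; last by nra.
      apply: (@le_trans _ _ (g (x / 2))); first by apply: weight_le; lra.
      apply: (le_trans (weight_ub _)); rewrite gx mulrCA ler_wpM2l//.
      by rewrite invr_ge0 ltW.
    have : 0 <= g (x - z) * (z <= x / 2)%R%:R.
      by rewrite mulr_ge0// ltW// weight_gt0.
    by rewrite ler_norml => h; apply/andP; split; nra.
  apply: (@le_trans _ _ ((2 * `|z|) * ((C' + 1) * g x))).
    by apply: ler_pM => //; lra.
  have : 0 <= (e + K) * C * K / x.
    by rewrite divr_ge0 ?(ltW x0)// !mulr_ge0// ?(ltW C0)//; lra.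
  by nra.
have zx : z <= x / 2 by lra.
have := slow z; have -> : (`|z| <= x / 2) = true by lra.
move=> /(_ isT) s.
rewrite zx mulr1 -mulrBr normrM (gE (x - z)); last by lra.
rewrite gx -mulrBr normrM (gtr0_norm (_ : 0 < mu^-1)) ?invr_gt0//.
have i0 : 0 < mu^-1 by rewrite invr_gt0.
have I0 : 0 < I x by exact: (excess_gt0 nu_int tail_rv).
have h1 : `|I (x - z) - I x| <= C * K / x * I x.
  apply: (le_trans s); rewrite ler_wpM2r ?(ltW I0)// ler_wpM2r ?invr_ge0 ?(ltW x0)//.
  by rewrite ler_wpM2l ?(ltW C0).
have h2 : `|e - z| * `|I (x - z) - I x| <= (e + K) * (C * K / x * I x).
  by apply: ler_pM => //; lra.
have := ler_wpM2l (ltW i0) h2; lra.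
Qed.

(** Against typical jumps the weight is almost the constant [g x], and the mean of [e - z] is
    [e + mu]. The level [K] is fixed first, to make the tail moment cost [de / 2]; then [x] is taken
    so large that the [K / x] term costs no more. *)
Lemma small_jump_mean (e de : R) : 0 <= e -> 0 < de -> \forall x \near +oo,
  `|\int[nu]_z ((e - z) * g (x - z) * (z <= x / 2)%R%:R) - (e + mu) * g x|
    <= de * g x.
Proof.
move=> e0 de0.
have [C C0 hC] := excess_slow nu_int alpha_gt1 tail_rv.
have [C' C'0 hC'] := excess_half_le nu_int alpha_gt1 tail_rv.
have B0 : 0 < 2 * (C' + 1) by lra.
have [K0 K00 hK] := tail_moment_small nu_int (divr_gt0 de0 (mulr_gt0 (ltr0n R 2) B0)).
pose K := Num.max K0 e.
have eK : e <= K by rewrite le_max lexx orbT.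
have KM : tail_moment nu K <= de / (2 * (2 * (C' + 1))).
  by apply: hK; rewrite le_max lexx.
have A0 : 0 <= (e + K) * C * K by rewrite !mulr_ge0 ?(ltW C0)//; lra.
near=> x.
have x0 : 0 < x by near: x; exact: nbhs_pinfty_gt.
have Kx : 2 * K <= x by near: x; apply: nbhs_pinfty_ge; exact: num_real.
have gE s : x / 2 <= s -> g s = mu^-1 * I s.
  rewrite [x / 2]mulrC; move: s; near: x.
  apply: (@near_pinfty_scale _ (fun y => forall s, y <= s -> g s = mu^-1 * I s)).
    by rewrite invr_gt0.
  by apply: near_pinfty_forall; exact: weight_near.
have slow : forall y, `|y| <= x / 2 -> `|I (x - y) - I x| <= C * `|y| / x * I x.
  by near: x.
have half : I (x / 2) <= C' * I x by near: x.
have Ax : (e + K) * C * K / x <= de / 2.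
  rewrite ler_pdivrMr// [leRHS]mulrC -ler_pdivrMr; last by lra.
  by near: x; apply: nbhs_pinfty_ge; exact: num_real.
have jump := small_jump_dist e0 eK C0 C'0 x0 Kx gE slow half.
have a1 : affine_bounded (fun z => (e - z) * g (x - z) * (z <= x / 2)%R%:R).
  apply: affine_boundedMb; last by meas_tac.
  by apply: affine_bounded_weight; affine_tac.
have a2 : affine_bounded (fun z => (e - z) * g x).
  by apply: affine_boundedM; [affine_tac|meas_tac|move=> z];
    rewrite ger0_norm ?weight_le1// ltW// weight_gt0.
have -> : (e + mu) * g x = \int[nu]_z ((e - z) * g x).
  have -> : \int[nu]_z ((e - z) * g x) = \int[nu]_z (g x * (e - z)).
    by apply: eq_Rintegral => z _; rewrite mulrC.
  rewrite meanZ//; last by affine_tac.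
  rewrite meanB//; [|affine_tac..].
  by rewrite mean_cst mean_mu; ring.
rewrite -meanB//.
apply: le_trans (le_normr_Rintegral _ _) _ => //.
  by apply: integrable_affine_bounded => //; exact: affine_boundedB.
apply: (@le_trans _ _ (\int[nu]_z
    (g x * ((e + K) * C * K / x + 2 * (C' + 1) * (`|z| * (K < `|z|)%R%:R))))).
  apply: mean_le => //; last by affine_tac.
  by apply: affine_bounded_normr; exact: affine_boundedB.
rewrite meanZ//; last by affine_tac.
have gx0 := ltW (weight_gt0 x).
rewrite mulrC; apply: ler_wpM2r => //.
rewrite meanD//; [|affine_tac..].
rewrite mean_cst meanZ//; last by affine_tac.
have := ler_wpM2l (ltW B0) KM.
rewrite /tail_moment => h.
have h2 : 2 * (C' + 1) * (de / (2 * (2 * (C' + 1)))) = de / 2.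
  by field; lra.
rewrite h2 in h.
lra.
Unshelve. all: by end_near. Qed.

End weight.

(** * Balance of small and large jumps *)

Section jumps.
Context {R : realType} (nu : probability R R).
Hypothesis nu_int : nu.-integrable setT (EFin \o @idfun R).
Variable alpha : R.
Hypothesis alpha_gt1 : 1 < alpha.
Hypothesis tail_rv : regularly_varying_tail (tail nu) alpha.
Variable mu : R.
Hypothesis mu_gt0 : 0 < mu.
Hypothesis mean_mu : \int[nu]_x x = - mu.

Local Notation Fb := (tail nu).
Local Notation I := (excess nu).
Local Notation g := (weight nu mu).

Let Fb_gt0 := tail_gt0 nu_int tail_rv.
Let I_gt0 := excess_gt0 nu_int tail_rv.
Let g_gt0 := weight_gt0 nu_int tail_rv mu_gt0.
Let g_near := weight_near nu_int mu_gt0.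
Let jumps := small_jump_mean nu_int alpha_gt1 tail_rv mu_gt0 mean_mu.

(** Far out [g x = I x / mu], so the drift [mu] cancels and [1] remains as the leading factor of the
    excess. *)
Let small_jump_le (e de : R) : 0 <= e -> 0 < de -> \forall x \near +oo,
  \int[nu]_z ((e - z) * g (x - z) * (z <= x / 2)%R%:R) <=
    (1 + (e + de) / mu) * I x.
Proof.
move=> e0 de0; near=> x.
have : `|\int[nu]_z ((e - z) * g (x - z) * (z <= x / 2)%R%:R) - (e + mu) * g x|
    <= de * g x by near: x; exact: jumps.
have -> : g x = mu^-1 * I x by near: x; exact: g_near.
have -> : (1 + (e + de) / mu) * I x = (e + mu) * (mu^-1 * I x) + de * (mu^-1 * I x).
  by field; rewrite gt_eqF.
by rewrite ler_norml => /andP[_]; lra.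
Unshelve. all: by end_near. Qed.

(** Up to constants the left side is [I x], hence at most of order [x * Fb x], and [Fb x] is of
    order at most [Fb (2 * x) <= Fb (x + M)]. The constants collect in [D], which [ln x]
    outgrows. *)
Lemma small_jump_le_ln (M : R) : \forall x \near +oo,
  \int[nu]_z ((1 - z) * g (x - z) * (z <= x / 2)%R%:R) <=
    (x * ln x - 1) * Fb (x + M).
Proof.
have [C C0 hC] := excess_tail_le nu_int alpha_gt1 tail_rv.
have p0 : 0 < 2 `^ (- alpha) :> R by exact: powR_gt0.
set q := 2 `^ (- alpha) / 2.
have q0 : 0 < q by rewrite divr_gt0.
have qlt : q < 2 `^ (- alpha) by rewrite /q; lra.
pose D := (1 + (1 + 1) / mu) * C / q.
near=> x.
have x1 : 1 <= x by near: x; apply: nbhs_pinfty_ge; exact: num_real.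
have x0 : 0 < x by lra.
have h1 : \int[nu]_z ((1 - z) * g (x - z) * (z <= x / 2)%R%:R) <=
    (1 + (1 + 1) / mu) * I x by near: x; exact: small_jump_le.
have h2 : I x <= C * (x * Fb x) by near: x.
have h3 : q * Fb x <= Fb (2 * x).
  by near: x; exact: (tail_scale_ge nu_int tail_rv).
have h4 : Fb (2 * x) <= Fb (x + M).
  apply: tail_le => //; rewrite mulr_natl mulr2n lerD2l.
  by near: x; apply: nbhs_pinfty_ge; exact: num_real.
have c0 : 0 <= 1 + (1 + 1) / mu by rewrite addr_ge0 ?divr_ge0 ?(ltW mu_gt0)//.
have D0 : 0 <= D by rewrite /D divr_ge0 ?mulr_ge0 ?(ltW C0) ?(ltW q0).
have h5 : D + 1 <= ln x.
  have Dx : expR (D + 1) <= x.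
    by near: x; apply: nbhs_pinfty_ge; exact: num_real.
  by rewrite -ler_expR lnK ?posrE.
have F0 := Fb_gt0 x.
apply: (le_trans h1); apply: (le_trans (ler_wpM2l c0 h2)).
apply: (@le_trans _ _ (x * D * (q * Fb x))).
  rewrite le_eqVlt; apply/orP; left; apply/eqP; rewrite /D.
  by field; rewrite ?gt_eqF //; lra.
have xD : x * D <= x * ln x - 1.
  by have := ler_wpM2l (ltW x0) h5; lra.
apply: ler_pM => //; [by rewrite mulr_ge0// ltW|by rewrite mulr_ge0// ltW|].
exact: le_trans h3 h4.
Unshelve. all: by end_near. Qed.

(* At l = 1 both sides vanish and their derivatives differ by alpha - 2. *)
Lemma karamata_scale_exists : 2 < alpha ->
  exists2 l : R, 1 < l & l - 1 < l `^ (- alpha) * (1 - l * l `^ (- alpha)).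
Proof.
move=> a2; have [s sE] : exists s, s = 2 * alpha - 1 by exists (2 * alpha - 1).
(* With [l = expR t], the bounds [b1] to [b5] leave a gap of at least
   [(alpha - 2) * t - (2 + s ^+ 2) * t ^+ 2]; this [t] makes the quadratic term half of the linear
   one. *)
pose t := (alpha - 2) / (2 * (2 + s ^+ 2)).
have s0 : 3 < s by lra.
have d0 : 0 < 2 * (2 + s ^+ 2) by have := sqr_ge0 s; lra.
have t0 : 0 < t by rewrite divr_gt0//; lra.
have ht : t * (2 * (2 + s ^+ 2)) = alpha - 2 by rewrite /t divfK// gt_eqF.
clearbody t.
have s2 : s ^+ 2 = s * s by rewrite expr2.
have t12 : t < 2^-1 by nra.
exists (expR t); first by rewrite -expR0 ltr_expR.
have e1 : expR t `^ (- alpha) = expR (- alpha * t).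
  by rewrite gt0_powRE ?expR_gt0// expRK.
have -> : expR t `^ (- alpha) * (1 - expR t * expR t `^ (- alpha)) =
    expR (- alpha * t) - expR (- (s * t)).
  rewrite e1 mulrBr mulr1; congr (_ - _); rewrite -!expRD; congr expR.
  by rewrite sE; ring.
have b1 := expR_ge1Dx (- alpha * t).
have b2 : expR t <= (1 - t)^-1.
  rewrite -[leLHS]invrK lef_pV2 ?posrE ?invr_gt0 ?expR_gt0//; last by lra.
  by rewrite -expRN; exact: expR_ge1Dx.
have b3 : expR (- (s * t)) <= (1 + s * t)^-1.
  rewrite expRN lef_pV2 ?posrE ?expR_gt0//; last by nra.
  exact: expR_ge1Dx.
have b4 : (1 - t)^-1 <= 1 + t + 2 * t * t.
  rewrite -[leLHS]mul1r ler_pdivrMr; last by lra.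
  by nra.
have b5 : (1 + s * t)^-1 <= 1 - s * t + s * s * t * t.
  rewrite -[leLHS]mul1r ler_pdivrMr; last by nra.
  have : 0 <= (s * t) * (s * t) * (s * t) by rewrite !mulr_ge0//; lra.
  by lra.
rewrite s2 in ht.
have : 0 < t * (2 + s * s) * t by rewrite !mulr_gt0//; nra.
have : t * (t * (2 * (2 + s * s))) = t * (alpha - 2) by rewrite ht.
have : s * t = 2 * alpha * t - t by rewrite sE; ring.
by lra.
Qed.

(** At a scale [l] from [karamata_scale_exists], the loss [x * Fb (x + M)] exceeds [I x] by a factor
    [th > 1], even after [Fb (x + M)] is replaced by its lower bound [Fb (l * x)]. The margin
    [th - 1] pays for [e]. *)
Lemma small_jump_le_id (M : R) : 2 < alpha -> exists2 e : R, 0 < e &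
  \forall x \near +oo,
  \int[nu]_z ((e - z) * g (x - z) * (z <= x / 2)%R%:R) <= (x - e) * Fb (x + M).
Proof.
move=> a2; have [l l1 hl] := karamata_scale_exists a2.
set q0 := l `^ (- alpha) in hl.
have q00 : 0 < q0 by rewrite powR_gt0//; lra.
have lq1 : 0 < 1 - l * q0.
  by rewrite -(pmulr_rgt0 _ q00); apply: lt_trans hl; lra.
pose eta := (q0 * (1 - l * q0) - (l - 1)) / 2.
(* Shifting [q0] to [q0 + eta] and [q0 - eta] turns [q0 * (1 - l * q0)] into itself minus [eta] plus
   [l * eta * eta], so half of the gap suffices as [eta]. *)
have eta0 : 0 < eta by rewrite /eta; lra.
have etaq : eta <= q0 / 2.
  have : 0 <= l * q0 * q0 by rewrite !mulr_ge0 ?(ltW q00)//; lra.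
  by rewrite /eta; lra.
pose q := q0 + eta; pose q' := q0 - eta.
have gap : l - 1 < q' * (1 - l * q).
  have le2 : 0 < l * eta * eta by rewrite !mulr_gt0//; lra.
  have eta2 : 2 * eta = q0 * (1 - l * q0) - (l - 1) by rewrite /eta; lra.
  by rewrite /q /q'; lra.
have q'0 : 0 < q' by rewrite /q'; lra.
pose th := q' * (1 - l * q) / (l - 1).
have th1 : 1 < th by rewrite /th ltr_pdivlMr ?mul1r//; lra.
(* Makes [(e + e) / mu] equal to half of the margin [th - 1]; the other half absorbs the [- e] in
   [x - e] once [x] exceeds the constant [E] below. *)
pose e := mu * (th - 1) / 4.
have e0 : 0 < e by rewrite /e divr_gt0// mulr_gt0//; lra.
have thE : q' * (1 - l * q) = th * (l - 1) by rewrite /th divfK// gt_eqF//; lra.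
have eE : 1 + (e + e) / mu = (1 + th) / 2 by rewrite /e; field; rewrite gt_eqF.
have qlt : q0 < q by rewrite /q; lra.
have q'lt : q' < q0 by rewrite /q'; lra.
clearbody q q' th e; clear hl lq1 etaq eta0 gap; clearbody eta.
pose E := e * (2 * th) / (th - 1).
have EE : E * (th - 1) = e * (2 * th) by rewrite /E divfK// gt_eqF//; lra.
clearbody E.
exists e => //; near=> x.
have h1 : \int[nu]_z ((e - z) * g (x - z) * (z <= x / 2)%R%:R) <=
    (1 + (e + e) / mu) * I x by near: x; exact: (small_jump_le (ltW e0) e0).
have xe : E <= x.
  by near: x; apply: nbhs_pinfty_ge; exact: num_real.
have x1 : 0 < x by near: x; exact: nbhs_pinfty_gt.
have xe' : e < x by near: x; apply: nbhs_pinfty_gt; exact: num_real.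
have h2 : (1 - l * q) * I x <= (l - 1) * x * Fb x.
  by near: x; apply: (excess_le_tail nu_int tail_rv).
have h3 : q' * Fb x <= Fb (l * x).
  by near: x; apply: (tail_scale_ge nu_int tail_rv) => //; lra.
have h4 : Fb (l * x) <= Fb (x + M).
  apply: tail_le => //.
  have : M / (l - 1) <= x by near: x; apply: nbhs_pinfty_ge; exact: num_real.
  by rewrite ler_pdivrMr; lra.
apply: (le_trans h1); clear h1.
rewrite eE.
have I0 := I_gt0 x.
have xe0 : 0 <= x - e by lra.
apply: (@le_trans _ _ ((x - e) * (q' * Fb x))); last first.
  by rewrite ler_wpM2l//; exact: le_trans h3 h4.
have h5 : th * I x <= q' * (x * Fb x).
  have l10 : 0 < l - 1 by lra.
  rewrite -(ler_pM2r l10) mulrAC -thE.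
  by have := ler_wpM2l (ltW q'0) h2; lra.
have th10 : 0 <= th - 1 by lra.
have xe2 := ler_wpM2r th10 xe.
have h6 : (x - e) * (th * I x) <= (x - e) * (q' * (x * Fb x)) by rewrite ler_wpM2l.
have h7 : (1 + th) / 2 * I x * x <= (x - e) * (th * I x).
  have : (1 + th) / 2 * x <= (x - e) * th by lra.
  by move=> h; have := ler_wpM2r (ltW I0) h; lra.
by rewrite -(ler_pM2r x1); lra.
Unshelve. all: by end_near. Qed.

(** Beyond [x / 2] the factor [Num.min z x] is at most [x], and the weight is at most 1 for
    [z > x - K] and at most [g K] before. The form [0 - z] makes the rest an instance of
    [small_jump_mean] with [e = 0]. *)
Let large_jump_split (x K : R) : 0 < x ->
  \int[nu]_z (Num.min z x * g (x - z)) <= x * (Fb (x - K) + g K * Fb (x / 2)) -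
    \int[nu]_z ((0 - z) * g (x - z) * (z <= x / 2)%R%:R).
Proof.
move=> x0.
have aw := affine_bounded_weight nu_int tail_rv mu_gt0 x.
have a1 : affine_bounded (fun z => (0 - z) * g (x - z) * (z <= x / 2)%R%:R).
  by apply: affine_boundedMb; [apply: aw; affine_tac|meas_tac].
apply: (@le_trans _ _ (\int[nu]_z
    (x * ((x - K < z)%R%:R + g K * (x / 2 < z)%R%:R)
     - ((0 - z) * g (x - z) * (z <= x / 2)%R%:R)))).
  apply: mean_le => //; [by apply: aw; affine_tac| |move=> z].
    by apply: affine_boundedB => //; affine_tac.
  have gz := g_gt0 (x - z); have gz1 := weight_le1 nu mu (x - z).
  have b0 : 0 <= (x - K < z)%R%:R :> R by [].
  have xb0 := mulr_ge0 (ltW x0) b0.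
  case: (leP z (x / 2)) => zx; rewrite ?mulr1 ?mulr0 ?addr0.
    by rewrite (min_l (_ : z <= x)); lra.
  rewrite subr0; apply: (@le_trans _ _ (x * g (x - z))).
    by apply: ler_wpM2r; [exact: ltW|rewrite ge_min lexx orbT].
  apply: ler_wpM2l; first exact: ltW.
  have gK0 := g_gt0 K.
  case: ltP => zK; first by rewrite mulr1n; lra.
  by rewrite mulr0n add0r; apply: (weight_le nu_int mu_gt0); lra.
rewrite meanB//; last by affine_tac.
rewrite meanZ//; last by affine_tac.
rewrite meanD//; [|affine_tac..].
by rewrite meanZ//; affine_tac.
Qed.

(** Here [6 / 17] solves [1 - 2 * k = 5 / 6 * k] and lies just below the value of [2 ^ (- alpha)] at
    [alpha = 3 / 2]. The other two compare the tail at [x / 2] and slightly before [x] with the tail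
    at [x]. *)
Lemma powR_lt32 : alpha < 3 / 2 ->
  [/\ 6 / 17 < 2 `^ (- alpha) :> R, 2^-1 `^ (- alpha) < 3 :> R &
      (20 / 21) `^ (- alpha) < 10 / 9 :> R].
Proof.
move=> a32; have y0 : 0 < 2 `^ (- (3 / 2)) :> R by exact: powR_gt0.
have y2 : 2 `^ (- (3 / 2)) * 2 `^ (- (3 / 2)) = 8^-1 :> R.
  rewrite -powRD; last by apply/implyP => _; rewrite pnatr_eq0.
  rewrite (_ : - (3 / 2) + - (3 / 2) = - 3%:R); last by lra.
  by rewrite powRN powR_mulrn//; congr (_^-1); ring.
have y1 : 2 `^ (- (3 / 2)) <= 2 `^ (- alpha) :> R.
  by rewrite ler_powR ?ler1n//; lra.
have p2 : 6 / 17 < 2 `^ (- alpha) :> R by nra.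
split => //.
  have -> : 2^-1 `^ (- alpha) = (2 `^ (- alpha))^-1 :> R.
    by rewrite !gt0_powRE// lnV ?posrE// mulrN expRN.
  rewrite -[ltLHS]mul1r ltr_pdivrMr; last exact: powR_gt0.
  by lra.
have [l lE] : exists l : R, l = 20 / 21 by exists (20 / 21).
have l0 : 0 < l by lra.
rewrite -lE; apply: (@le_lt_trans _ _ (l `^ (- 2%:R))).
  rewrite !gt0_powRE// ler_expR.
  have : ln l <= 0 by apply: ln_le0; lra.
  by nra.
rewrite powRN powR_mulrn; last exact: ltW.
rewrite -[ltLHS]mul1r ltr_pdivrMr; last by rewrite exprn_gt0.
by rewrite expr2 lE; lra.
Qed.

(* tail_le_excess with l = 2 gives x Fb x <= (2^alpha - 2) I x up to a small
   error, and 2^alpha - 2 < 5 / 6 for alpha < 3 / 2. *)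
Lemma large_jump_lt : alpha < 3 / 2 -> \forall x \near +oo,
  \int[nu]_z (Num.min z x * g (x - z)) < 0.
Proof.
move=> /powR_lt32[].
have : (20 / 21 : R) < 1 by lra.
have : 0 < (20 / 21 : R) by lra.
have : 0 < (6 / 17 : R) by lra.
have : 1 - 2 * (6 / 17) <= 5 / 6 * (6 / 17) :> R by lra.
move: (20 / 21) (6 / 17) => l k hk k0 l0 l1 pk ph pl.
have l12 : 1 < 2 :> R by rewrite ltr1n.
have mu50 : 0 < mu / 50 by rewrite divr_gt0.
have mu60 : 0 < mu / 60 by rewrite divr_gt0.
have [K hK] := filter_ex (excess_near_le nu_int mu60).
have gK : g K <= 60^-1.
  by apply: (le_trans (weight_ub _ _ _)); rewrite ler_pdivrMl.
near=> x.
have x0 : 0 < x by near: x; exact: nbhs_pinfty_gt.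
apply: (le_lt_trans (large_jump_split K x0)).
have Fx : Fb (x - K) <= 10 / 9 * Fb x.
  apply: (@le_trans _ _ (Fb (l * x))).
    apply: tail_le => //.
    have : K / (1 - l) <= x by near: x; apply: nbhs_pinfty_ge; exact: num_real.
    by rewrite ler_pdivrMr; lra.
  by near: x; exact: (tail_scale_le nu_int tail_rv l0 pl).
have Fx2 : g K * Fb (x / 2) <= 60^-1 * (3 * Fb x).
  apply: ler_pM => //; [exact/ltW/g_gt0|exact: tail_ge0|].
  rewrite [x / 2]mulrC; near: x; apply: (tail_scale_le nu_int tail_rv) => //.
have h1 : `|\int[nu]_z ((0 - z) * g (x - z) * (z <= x / 2)%R%:R) - (0 + mu) * g x|
    <= mu / 50 * g x by near: x; exact: jumps.
have gI : g x = mu^-1 * I x by near: x; exact: g_near.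
have h2 : (2 - 1) * k * (x * Fb x) <= (1 - 2 * k) * I x.
  by near: x; exact: (tail_le_excess nu_int tail_rv l12 (ltW k0) pk).
move: h1; rewrite gI ler_norml => /andP[h1 _].
have e1 : (0 + mu) * (mu^-1 * I x) = I x.
  by rewrite add0r mulrA mulfV ?mul1r// gt_eqF.
have e2 : mu / 50 * (mu^-1 * I x) = I x / 50 by field; rewrite gt_eqF.
rewrite e1 e2 in h1.
have I0 := I_gt0 x.
have h3 : k * (x * Fb x) <= 5 / 6 * k * I x.
  by have := ler_wpM2r (ltW I0) hk; lra.
have h4 : x * Fb x <= 5 / 6 * I x by rewrite -(ler_pM2l k0); lra.
(* The budget closes because [(10 / 9 + 3 / 60) * (5 / 6) < 1 - 1 / 50]. *)
have h5 := ler_wpM2l (ltW x0) (lerD Fx Fx2).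
lra.
Unshelve. all: by end_near. Qed.

End jumps.

(** * One-step drift of the test functions *)

Section kernel_drift.
Context {R : realType} (nu : probability R R).
Hypothesis nu_int : nu.-integrable setT (EFin \o @idfun R).
Variable alpha : R.
Hypothesis alpha_gt1 : 1 < alpha.
Hypothesis tail_rv : regularly_varying_tail (tail nu) alpha.
Variable mu : R.
Hypothesis mu_gt0 : 0 < mu.
Hypothesis mean_mu : \int[nu]_x x = - mu.

Local Notation Fb := (tail nu).
Local Notation g := (weight nu mu).

Let g_gt0 := weight_gt0 nu_int tail_rv mu_gt0.
Let affine_g := affine_bounded_weight nu_int tail_rv mu_gt0.

Let affine_g1 (x : R) : affine_bounded (fun z => g (x - z)).
Proof.
have -> : (fun z => g (x - z)) = (fun z => 1 * g (x - z)).
  by apply/funext => z; rewrite mul1r.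
exact: (affine_g x (affine_bounded_cst 1)).
Qed.

(* Jumps in ]x / 2, x + 2 mu] only lower the right-hand side, and beyond
   x + 2 mu the weight is 1. *)
Let jump_reduction (F : R -> R) (k e L x : R) : affine_bounded F -> 0 < k ->
  (forall z, k * F z <=
     (e - z) * (z <= x / 2)%R%:R - L * (x + 2 * mu < z)%R%:R) ->
  \int[nu]_z ((e - z) * g (x - z) * (z <= x / 2)%R%:R) <= L * Fb (x + 2 * mu) ->
  \int[nu]_z (F z * g (x - z)) <= 0.
Proof.
move=> aF k0 FL hL; rewrite -(ler_pM2l k0) mulr0.
have a1 : affine_bounded (fun z => (e - z) * g (x - z) * (z <= x / 2)%R%:R).
  by apply: affine_boundedMb; [apply: affine_g; affine_tac|meas_tac].
rewrite -meanZ//; last exact: affine_g.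
apply: (@le_trans _ _ (\int[nu]_z ((e - z) * g (x - z) * (z <= x / 2)%R%:R -
    L * (x + 2 * mu < z)%R%:R))).
  apply: mean_le => //; [exact/affine_boundedZ/affine_g| |move=> z].
    by apply: affine_boundedB => //; affine_tac.
  have gz := g_gt0 (x - z).
  apply: (@le_trans _ _ (((e - z) * (z <= x / 2)%R%:R -
      L * (x + 2 * mu < z)%R%:R) * g (x - z))).
    by rewrite mulrA; apply: ler_wpM2r; [exact: ltW|exact: FL].
  case: (ltP (x + 2 * mu) z) => zx; rewrite ?mulr1 ?mulr0 ?subr0; last first.
    by rewrite mulrAC.
  rewrite (weight_eq1 nu_int mu_gt0 mean_mu); last by lra.
  by rewrite mulr1 mulrAC mulr1.
rewrite meanB//; last by affine_tac.
by rewrite meanZ ?subr_le0//; affine_tac.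
Qed.

(** Reduces each drift bound to the sign of one weighted integral, without dividing by the
    normalising constant. *)
Let mean_weight_sub (F : R -> R) (k x : R) : affine_bounded F ->
  \int[nu]_z ((F z - k) * g (x - z)) =
  \int[nu]_z (F z * g (x - z)) - k * \int[nu]_z g (x - z).
Proof.
move=> aF; rewrite -meanZ//.
rewrite -meanB//; [|exact: affine_g|exact/affine_boundedZ/affine_g1].
by apply: eq_Rintegral => z _; rewrite mulrBl.
Qed.

(** The killing level [c] is quantified after the threshold for [x], so that [c] itself can later be
    placed beyond that threshold. *)
Lemma drift_id : 2 < alpha -> exists2 e : R, 0 < e & \forall x \near +oo,
  forall c, 0 <= c <= x ->
  \int[nu]_z ((x - z) * (c <= x - z)%R%:R * g (x - z)) <=
    (x - e) * \int[nu]_z g (x - z).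
Proof.
move=> a2; have [e e0 he] :=
  small_jump_le_id nu_int alpha_gt1 tail_rv mu_gt0 mean_mu (2 * mu) a2.
exists e => //; near=> x => c /andP[c0 cx].
have xe : 2 * e <= x by near: x; apply: nbhs_pinfty_ge; exact: num_real.
have hx : \int[nu]_z ((e - z) * g (x - z) * (z <= x / 2)%R%:R) <=
  (x - e) * Fb (x + 2 * mu) by near: x; exact: he.
have aF : affine_bounded (fun z => (x - z) * (c <= x - z)%R%:R) by affine_tac.
rewrite -subr_le0 -mean_weight_sub//.
apply: (jump_reduction _ ltr01 _ hx); first by affine_tac.
move=> z; case: (leP c (x - z)) => h1; case: (leP z (x / 2)) => h2;
  case: (ltP (x + 2 * mu) z) => h3; rewrite ?mulr1 ?mulr0; have := mu_gt0; lra.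
Unshelve. all: by end_near. Qed.

Lemma affine_bounded_ln (x c : R) : 1 <= c ->
  affine_bounded (fun z => ln (x - z) * (c <= x - z)%R%:R).
Proof.
move=> c1; split.
  apply: measurable_funM; last by apply: measurable_bool_nat; meas_tac.
  by apply: measurableT_comp; [exact: measurable_ln|meas_tac].
exists (1 + `|x|) => z.
have z0 := normr_ge0 z; have x0 := normr_ge0 x.
have x1 := ler_norm x; have z1 := ler_norm (- z); rewrite normrN in z1.
case: (leP c (x - z)) => h; rewrite ?mulr1 ?mulr0 ?normr0; last by nra.
have l0 : 0 <= ln (x - z) by apply: ln_ge0; lra.
rewrite ger0_norm//.
have l1 : ln (1 + (x - z - 1)) <= x - z - 1 by apply: le_ln1Dx; lra.
by rewrite addrC subrK in l1; nra.
Qed.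

(** By concavity [ln (x - z) <= ln x - z / x]. Multiplication by [x] turns the increment plus [x^-1]
    into at most [1 - z], and the loss at an ending jump into [x * ln x - 1]: the case [k = x],
    [e = 1] of [jump_reduction]. *)
Lemma drift_ln : \forall x \near +oo, forall c, 1 <= c <= x ->
  \int[nu]_z (ln (x - z) * (c <= x - z)%R%:R * g (x - z)) <=
    (ln x - x^-1) * \int[nu]_z g (x - z).
Proof.
have he := small_jump_le_ln nu_int alpha_gt1 tail_rv mu_gt0 mean_mu (2 * mu).
near=> x => c /andP[c1 cx].
have x2 : 2 <= x by near: x; apply: nbhs_pinfty_ge; exact: num_real.
have xE : expR 1 <= x by near: x; apply: nbhs_pinfty_ge; exact: num_real.
have x0 : 0 < x by lra.
have lx : 1 <= ln x by rewrite -ler_expR lnK ?posrE.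
have hx : \int[nu]_z ((1 - z) * g (x - z) * (z <= x / 2)%R%:R) <=
  (x * ln x - 1) * Fb (x + 2 * mu) by near: x; exact: he.
have aF := affine_bounded_ln x c1.
rewrite -subr_le0 -mean_weight_sub//.
apply: (jump_reduction _ x0 _ hx); first by apply: affine_boundedB => //; affine_tac.
(* Needed when a jump [z <= x / 2] already ends the excursion: then [z <= x * ln x]. *)
have xlx : x <= x * ln x by rewrite ler_peMr// ltW.
have xV : x * x^-1 = 1 by rewrite mulfV// gt_eqF.
move=> z; rewrite mulrBr mulrBr xV.
have zln : c <= x - z -> x * ln (x - z) <= x * ln x - z.
  move=> cz; have -> : x - z = x * (1 + - (z / x)) by field; rewrite gt_eqF.
  have zx1 : z / x < 1 by rewrite ltr_pdivrMr//; lra.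
  rewrite lnM ?posrE//; last by lra.
  have : ln (1 + - (z / x)) <= - (z / x) by apply: le_ln1Dx; lra.
  move=> /(ler_wpM2l (ltW x0)).
  have -> : x * - (z / x) = - z by field; rewrite gt_eqF.
  by rewrite mulrDr; lra.
case: (leP c (x - z)) => h1; case: (leP z (x / 2)) => h2;
  case: (ltP (x + 2 * mu) z) => h3; rewrite ?mulr1 ?mulr0;
  have := mu_gt0; try have := zln h1; lra.
Unshelve. all: by end_near. Qed.

(** The increment of the positive part is [- Num.min z (x - c)], which is at least [- Num.min z x],
    so [large_jump_lt] applies. *)
Lemma drift_excess_gt : alpha < 3 / 2 -> \forall x \near +oo,
  forall c, 0 <= c <= x ->
  (x - c) * \int[nu]_z g (x - z) <
    \int[nu]_z (Num.max (x - c - z) 0 * g (x - z)).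
Proof.
move=> a32; near=> x => c /andP[c0 cx].
have hx : \int[nu]_z (Num.min z x * g (x - z)) < 0.
  by near: x; exact: (large_jump_lt nu_int alpha_gt1 tail_rv mu_gt0 mean_mu a32).
have am : affine_bounded (fun z => Num.min z x * g (x - z)).
  by apply: affine_g; affine_tac.
rewrite -subr_gt0 -mean_weight_sub; last by affine_tac.
apply: (@lt_le_trans _ _ (\int[nu]_z (-1 * (Num.min z x * g (x - z))))).
  by rewrite meanZ// mulN1r oppr_gt0.
apply: mean_le => //; [exact: affine_boundedZ|by apply: affine_g; affine_tac|].
move=> z; rewrite mulrA ler_wpM2r ?(ltW (g_gt0 _))//.
by case: (leP z x) => zx; case: (leP (x - c - z) 0) => h; lra.
Unshelve. all: by end_near. Qed.

(** Only jumps [z < 0] increase the positive part, and these have weight at most [g x], while jumps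
    [z > 0] alone give the normalising constant at least [g x * Fb 0]. The factor [g x] cancels,
    hence a bound uniform in [a] and [x]. *)
Lemma drift_excess_le : exists2 K : R, 0 <= K & forall a x,
  \int[nu]_z (Num.max (a - z) 0 * g (x - z)) <=
    (Num.max a 0 + K) * \int[nu]_z g (x - z).
Proof.
have F0 := tail_gt0 nu_int tail_rv 0.
pose N := \int[nu]_z Num.max (- z) 0.
have N0 : 0 <= N by apply: Rintegral_ge0 => z _; rewrite le_max lexx orbT.
exists (N / Fb 0); first by rewrite divr_ge0// ltW.
move=> a x; rewrite mulrDl.
have gx := g_gt0 x.
have w1 : g x * Fb 0 <= \int[nu]_z g (x - z).
  rewrite -meanZ//; last by affine_tac.
  apply: mean_le => //; [affine_tac|move=> z].
  have gz := g_gt0 (x - z).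
  case: (ltP 0 z) => z0; rewrite ?mulr1 ?mulr0; last exact: ltW.
  by apply: (weight_le nu_int mu_gt0); lra.
apply: (@le_trans _ _ (\int[nu]_z (Num.max a 0 * g (x - z) + g x * Num.max (- z) 0))).
  apply: mean_le => //; [by apply: affine_g; affine_tac| |move=> z].
    by apply: affine_boundedD; [exact: affine_boundedZ|affine_tac].
  have gz := g_gt0 (x - z).
  have gzx : g (x - z) * Num.max (- z) 0 <= g x * Num.max (- z) 0.
    case: (leP (- z) 0) => z0; rewrite ?mulr0// ler_wpM2r//; first exact: ltW.
    by apply: (weight_le nu_int mu_gt0); lra.
  apply: (@le_trans _ _ ((Num.max a 0 + Num.max (- z) 0) * g (x - z))).
    rewrite ler_wpM2r ?(ltW gz)//.
    by case: (leP (a - z) 0); case: (leP a 0); case: (leP (- z) 0); lra.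
  by rewrite mulrDl lerD2l mulrC.
rewrite meanD//; [|exact: affine_boundedZ|affine_tac].
rewrite !meanZ//; [|affine_tac].
rewrite lerD2l mulrAC ler_pdivlMr//.
by rewrite mulrAC [leRHS]mulrC ler_wpM2r.
Qed.

End kernel_drift.

(** * Markov chains with a density kernel *)

Section density.
Context d (T : measurableType d) (R : realType).
Import HBNNSimple.

(** Here [m] is the image under [U] of the measure with density [rho]. [chain_step] applies this to
    two representations of one measure. *)
Lemma ge0_integral_image_density (mu : {measure set T -> \bar R})
    (m : {measure set R -> \bar R}) (U : T -> R) (rho : T -> R) (f : R -> \bar R) :
  measurable_fun setT U -> measurable_fun setT rho -> (forall x, 0 <= rho x) ->
  (forall A, measurable A -> m A = (\int[mu]_x (\1_A (U x) * rho x)%:E)%E) ->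
  measurable_fun setT f -> (forall y, (0 <= f y)%E) ->
  (\int[m]_y f y = \int[mu]_x (f (U x) * (rho x)%:E))%E.
Proof.
move=> mU mrho rho0 mE mf f0.
pose h := nnsfun_approx measurableT mf.
have nd x : {homo (fun n => (h n x)%:E) : i j / (i <= j)%N >-> (i <= j)%E}.
  by move=> i j ij; rewrite lee_fin; exact/lefP/nd_nnsfun_approx.
have cvg_h x : (h n x)%:E @[n --> \oo] --> f x by exact: cvg_nnsfun_approx.
transitivity (limn (fun n => \int[m]_y (h n y)%:E))%E.
  rewrite -monotone_convergence//.
  - by apply: eq_integral => y _; apply/esym/cvg_lim.
  - by move=> n; exact/measurable_EFinP.
  - by move=> n y _; rewrite lee_fin.
transitivity (limn (fun n => \int[mu]_x (h n (U x) * rho x)%:E))%E; last first.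
  rewrite -monotone_convergence//.
  - apply: eq_integral => x _; apply/cvg_lim => //.
    apply: (@cvg_trans _ ((fun n => (h n (U x))%:E * (rho x)%:E)%E @ \oo)) => //.
    by apply: cvgeZr.
  - move=> n; apply/measurable_EFinP; apply: measurable_funM => //.
    exact: measurableT_comp.
  - by move=> n x _; rewrite lee_fin mulr_ge0.
  - by move=> x _ i j ij; rewrite !EFinM lee_wpmul2r ?lee_fin//; exact: nd.
apply: congr_lim; apply/funext => n.
rewrite integralT_nnsfun sintegralE.
transitivity (\sum_(r \in range (h n)) (\int[mu]_x
    (r * (\1_(h n @^-1` [set r]) (U x) * rho x))%:E))%E.
  apply: eq_fsbigr => r /[!inE] -[y _ <-].
  have r0 : 0 <= h n y by [].
  under eq_integral do rewrite EFinM.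
  rewrite ge0_integralZl_EFin//.
  - by rewrite mE.
  - by move=> x _; rewrite lee_fin mulr_ge0.
  - apply/measurable_EFinP; apply: measurable_funM => //.
    by apply: measurableT_comp => //; exact: measurable_indic.
rewrite -ge0_integral_fsum//.
- apply: eq_integral => x _; rewrite fsumEFin//; congr EFin.
  rewrite fimfunE mulr_fsuml.
  by apply: eq_fsbigr => r _; rewrite mulrA.
- move=> r; apply/measurable_EFinP; apply: measurable_funM => //.
  apply: measurable_funM => //.
  by apply: measurableT_comp => //; exact: measurable_indic.
- move=> r x _; rewrite lee_fin indicE.
  case: (boolP (U x \in h n @^-1` [set r])) => [|_]; last by rewrite mul0r mulr0.
  by rewrite inE/= => <-; rewrite mul1r mulr_ge0.
Qed.

End density.

(** * The Markov property for nonnegative functions *)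

Section chain.
Context d (T : measurableType d) d' (Om : measurableType d') (R : realType).
Variables (P : probability T R) (X : {RV P >-> R}) (Q : probability Om R).
Variables (S : nat -> {mfun Om >-> R}) (r : R -> R -> R).
Hypothesis mr : measurable_fun setT (fun p : R * R => r p.1 p.2).
Hypothesis r_ge0 : forall y z, 0 <= r y z.
Variable x0 : R.

(** [bg_kernel] is this kernel for [r] the ratio of [bg_v] to [bg_w]. *)
Definition density_kernel (y : R) (A : set R) : \bar R :=
  (\int[walk_kernel P X y]_(z in A) (r y z)%:E)%E.

Hypothesis SQ : markov_chain Q S x0 density_kernel.

Definition density_mean (phi : R -> R) (y : R) : \bar R :=
  (\int[P]_t (phi (y + X t) * r y (y + X t))%:E)%E.

Let measurable_shift (y : R) : measurable_fun setT (fun t => y + X t).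
Proof. by apply: measurable_funD; [exact: measurable_cst|exact: measurable_funPT]. Qed.

Let measurable_r (y : R) : measurable_fun setT (r y).
Proof. exact: (measurableT_comp mr (pair1_measurable y)). Qed.

Let density_kernelE (y : R) A : measurable A ->
  density_kernel y A = (\int[P]_t (\1_A (y + X t) * r y (y + X t))%:E)%E.
Proof.
move=> mA; transitivity
    (\int[P]_(t in (fun t => y + X t)%R @^-1` A) (r y (y + X t))%:E)%E.
  apply: (ge0_integral_pushforward (measurable_shift y)) => //.
    by apply/measurable_EFinP; exact: measurable_funTS.
  by move=> z _; rewrite lee_fin.
rewrite integral_mkcond; apply: eq_integral => t _; rewrite patchE indicE/=.
rewrite (_ : (t \in _ @^-1` A) = (y + X t \in A)); last first.
  by apply/idP/idP; rewrite !inE.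
by case: ifPn => _; rewrite ?mul1r ?mul0r.
Qed.

Let measurable_product_shift (Z : {mfun Om >-> R}) :
  measurable_fun setT (fun p : Om * T => Z p.1 + X p.2).
Proof.
apply: measurable_funD.
  by apply: measurableT_comp; [exact: measurable_funPT|exact: measurable_fst].
by apply: measurableT_comp; [exact: measurable_funPT|exact: measurable_snd].
Qed.

Let measurable_product_r (Z : {mfun Om >-> R}) :
  measurable_fun setT (fun p : Om * T => r (Z p.1) (Z p.1 + X p.2)).
Proof.
have mZ : measurable_fun setT (fun p : Om * T => Z p.1).
  by apply: measurableT_comp; [exact: measurable_funPT|exact: measurable_fst].
exact: (measurableT_comp mr (measurable_fun_pair mZ (measurable_product_shift Z))).
Qed.

Let integrand_ge0 (phi : R -> R) y t : (forall z, 0 <= phi z) ->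
  (0 <= (phi (y + X t) * r y (y + X t))%:E)%E.
Proof. by move=> phi0; rewrite lee_fin mulr_ge0. Qed.

Lemma measurable_density_mean (phi : R -> R) (Z : {mfun Om >-> R}) :
  measurable_fun setT phi -> (forall z, 0 <= phi z) ->
  measurable_fun setT (fun w => density_mean phi (Z w)).
Proof.
move=> mphi phi0.
apply: (@measurable_fun_fubini_tonelli_F _ _ _ _ _ P
  (fun p : Om * T => (phi (Z p.1 + X p.2) * r (Z p.1) (Z p.1 + X p.2))%:E)).
  apply/measurable_EFinP; apply: measurable_funM => //.
  by apply: measurableT_comp => //; exact: measurable_product_shift.
by move=> p; exact: integrand_ge0.
Qed.

Lemma density_mean_ge0 (phi : R -> R) y : (forall z, 0 <= phi z) ->
  (0 <= density_mean phi y)%E.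
Proof. by move=> phi0; apply: integral_ge0 => t _; exact: integrand_ge0. Qed.

Let g_sigma_measurable n (E : set Om) :
  g_sigma_preimage (fun (i : 'I_n.+1) (w : Om) => S i w) E -> measurable E.
Proof.
apply: smallest_sub; first exact: sigma_algebra_measurable.
apply: (@big_ind _ (fun A => A `<=` measurable)) => //.
- by move=> A B hA hB E' [/hA|/hB].
- by move=> i _ _ [B mB <-]; rewrite setTI; exact: measurable_funPTI.
Qed.

(** The law [m] of [S n.+1] restricted to [E] is also the image under [S n + X], with [X] on an
    independent factor, of [Q \x P] weighted by [rho]: the Markov clause says so on sets, and
    integrals follow. *)
Lemma chain_step n (E : set Om) (phi : R -> R) :
  g_sigma_preimage (fun (i : 'I_n.+1) (w : Om) => S i w) E ->
  measurable_fun setT phi -> (forall z, 0 <= phi z) ->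
  (\int[Q]_(w in E) (phi (S n.+1 w))%:E =
   \int[Q]_(w in E) density_mean phi (S n w))%E.
Proof.
move=> gE mphi phi0; have mE := g_sigma_measurable gE.
pose m0 : {measure set R -> \bar R} :=
  pushforward (mrestr Q mE) (S n.+1).
pose m : {measure set R -> \bar R} := m0 (measurable_funPT (S n.+1)).
have mphiE : measurable_fun setT (EFin \o phi) by exact/measurable_EFinP.
have phiE0 y : (0 <= (EFin \o phi) y)%E by rewrite lee_fin.
have mE1 : measurable_fun setT (\1_E : Om -> R) by exact: measurable_indic.
transitivity (\int[m]_y (phi y)%:E)%E.
  rewrite (@ge0_integral_image_density _ _ _ Q m (S n.+1) (\1_E) (EFin \o phi))//.
    rewrite [LHS]integral_mkcond; apply: eq_integral => w _.
    rewrite patchE indicE; case: ifPn => _; by rewrite ?mule1 ?mule0.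
  move=> A mA; rewrite [LHS](_ : _ = Q (S n.+1 @^-1` A `&` E))//.
  rewrite -integral_indic//; last exact: measurable_funPTI.
  rewrite [LHS]integral_mkcond; apply: eq_integral => w _.
  rewrite patchE !indicE; case: ifPn => _; by rewrite ?mulr1 ?mulr0.
pose rho (p : Om * T) := \1_E p.1 * r (S n p.1) (S n p.1 + X p.2).
have mrho : measurable_fun setT rho.
  by apply: measurable_funM; [exact: measurableT_comp|exact: measurable_product_r].
have rho0 p : 0 <= rho p by rewrite /rho mulr_ge0.
have fold_E (f : R -> R) : measurable_fun setT f -> (forall z, 0 <= f z) ->
    (\int[(Q \x P)%E]_p (f (S n p.1 + X p.2)%R * rho p)%:E =
     \int[Q]_(w in E) density_mean f (S n w))%E.
  move=> mf f0; rewrite fubini_tonelli1.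
  - rewrite [RHS]integral_mkcond; apply: eq_integral => w _.
    rewrite /fubini_F /rho patchE/=; case: ifPn => wE.
      by apply: eq_integral => t _; rewrite indicE wE mul1r.
    by apply: integral0_eq => t _; rewrite indicE (negbTE wE) mul0r mulr0.
  - apply/measurable_EFinP; apply: measurable_funM => //.
    by apply: measurableT_comp => //; exact: measurable_product_shift.
  - by move=> p; rewrite lee_fin mulr_ge0.
rewrite (@ge0_integral_image_density _ _ _ (Q \x P)%E m
  (fun p : Om * T => S n p.1 + X p.2) rho (EFin \o phi))//.
- by rewrite -fold_E//; apply: eq_integral => p _; rewrite EFinM.
- move=> A mA; rewrite [LHS](_ : _ = Q (E `&` S n.+1 @^-1` A)).
    rewrite (SQ.2 n E A gE mA) fold_E//.
    by apply: eq_integral => w _; rewrite density_kernelE.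
  by rewrite setIC.
Qed.

End chain.

(** * The chain killed at the hitting time *)

Section hitting.
Context d (T : measurableType d) d' (Om : measurableType d') (R : realType).
Variables (P : probability T R) (X : {RV P >-> R}) (Q : probability Om R).
Variables (S : nat -> {mfun Om >-> R}) (r : R -> R -> R).
Hypothesis mr : measurable_fun setT (fun p : R * R => r p.1 p.2).
Hypothesis r_ge0 : forall y z, 0 <= r y z.
Variable x0 : R.
Hypothesis SQ : markov_chain Q S x0 (density_kernel X r).
Variable b : R.
Hypothesis x0b : x0 <= b.

(** The event that the hitting time exceeds [n]; it depends on [S 0, ..., S n] only. *)
Definition below (n : nat) : set Om := [set w | forall k, (k <= n)%N -> S k w <= b].

Let belowE n :
  below n = ~` (\bigcup_k [set w | (k <= n)%N /\ b < S k w]).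
Proof.
apply/seteqP; split => w /=.
  by move=> wn [k _ [kn]]; rewrite ltNge wn.
by move=> h k kn; rewrite leNgt; apply/negP => bS; apply: h; exists k.
Qed.

Let below_sigma n :
  g_sigma_preimage (fun (i : 'I_n.+1) (w : Om) => S i w) (below n).
Proof.
rewrite belowE.
apply: sigma_algebraC; apply: sigma_algebra_bigcup => k.
have [kn|nk] := leqP k n; last first.
  rewrite (_ : [set _ | _] = set0); first exact: sigma_algebra0.
  by apply/seteqP; split => w // -[].
apply: sub_sigma_algebra; rewrite -ltnS in kn.
rewrite -bigcup_mkord_ord; exists k => //=; rewrite inordK//.
exists `]b, +oo[%classic; first exact: measurable_itv.
apply/seteqP; split => w /=; rewrite in_itv/= andbT.
  by move=> [_ bS]; split.
by move=> [].
Qed.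

Let measurable_below n : measurable (below n).
Proof.
rewrite belowE.
apply: measurableC; apply: bigcup_measurable => k _.
have [kn|nk] := leqP k n; last first.
  by rewrite (_ : [set _ | _] = set0)//; apply/seteqP; split => w // -[].
rewrite (_ : [set _ | _] = S k @^-1` `]b, +oo[%classic).
  exact: measurable_funPTI.
by apply/seteqP; split => w /=; rewrite in_itv/= andbT => // -[].
Qed.

Definition killed (phi : R -> R) (n : nat) : \bar R :=
  (\int[Q]_(w in below n) (phi (S n w))%:E)%E.

Let killed_measurable (phi : R -> R) n D : measurable_fun setT phi ->
  measurable_fun D (fun w => (phi (S n w))%:E).
Proof.
move=> mphi; apply/measurable_EFinP; apply: measurable_funTS.
by apply: measurableT_comp => //; exact: measurable_funPT.
Qed.

Lemma killed_ge0 (phi : R -> R) n : (forall y, 0 <= phi y) -> (0 <= killed phi n)%E.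
Proof. by move=> phi0; apply: integral_ge0 => w _; rewrite lee_fin. Qed.

Lemma killed_cst (k : R) n : killed (fun=> k) n = (k%:E * Q (below n))%E.
Proof. by rewrite /killed integral_cst. Qed.

Lemma killed_le (phi psi : R -> R) n :
  measurable_fun setT phi -> measurable_fun setT psi ->
  (forall y, 0 <= phi y) -> (forall y, y <= b -> phi y <= psi y) ->
  (killed phi n <= killed psi n)%E.
Proof.
move=> mphi mpsi phi0 le; apply: ge0_le_integral => //.
- by move=> w _; rewrite lee_fin.
- exact: killed_measurable.
- exact: killed_measurable.
- by move=> w wn; rewrite lee_fin le// wn.
Qed.

Lemma killedD (phi psi : R -> R) n :
  measurable_fun setT phi -> measurable_fun setT psi ->
  (forall y, 0 <= phi y) -> (forall y, 0 <= psi y) ->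
  killed (fun y => phi y + psi y) n = (killed phi n + killed psi n)%E.
Proof.
move=> mphi mpsi phi0 psi0; rewrite /killed -ge0_integralD//.
- by move=> w _; rewrite lee_fin.
- exact: killed_measurable.
- by move=> w _; rewrite lee_fin.
- exact: killed_measurable.
Qed.

Lemma killedZ (k : R) (phi : R -> R) n : 0 <= k ->
  measurable_fun setT phi -> (forall y, 0 <= phi y) ->
  killed (fun y => k * phi y) n = (k%:E * killed phi n)%E.
Proof.
move=> k0 mphi phi0; rewrite /killed -ge0_integralZl_EFin//.
- by move=> w _; rewrite lee_fin.
- exact: killed_measurable.
Qed.

Lemma killed0 (phi : R -> R) : measurable_fun setT phi ->
  (forall y, 0 <= phi y) -> killed phi 0 = (phi x0)%:E.
Proof.
move=> mphi phi0; have [S0 _] := SQ.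
transitivity (\int[Q]_w (phi x0)%:E)%E; last first.
  by rewrite integral_cst// [X in (_ * X)%E]probability_setT mule1.
rewrite /killed integral_mkcond; apply: ae_eq_integral => //.
  by apply/(measurable_restrictT _ (measurable_below 0)); exact: killed_measurable.
move: S0; apply: filterS => w S0w _; rewrite patchE mem_set ?S0w// => k.
by rewrite leqn0 => /eqP->; rewrite S0w.
Qed.

(** Since [phi] vanishes above [b], survival at time [n.+1] need not be imposed, and the remaining
    event [below n] is in the past of step [n]. *)
Lemma killedS (phi : R -> R) n : measurable_fun setT phi ->
  (forall y, 0 <= phi y) -> (forall y, b < y -> phi y = 0) ->
  killed phi n.+1 = (\int[Q]_(w in below n) density_mean X r phi (S n w))%E.
Proof.
move=> mphi phi0 phib; rewrite -(chain_step mr r_ge0 SQ)//.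
rewrite /killed [LHS]integral_mkcond [RHS]integral_mkcond.
apply: eq_integral => w _; rewrite !patchE.
have [wn|wn] := boolP (w \in below n); last first.
  rewrite ifF//; apply/negbTE; apply: contra wn; rewrite !inE => h k kn.
  by apply: h; rewrite (leq_trans kn).
case: ifPn => // wn1; rewrite phib// ltNge; apply: contra wn1 => Sn.
rewrite inE => k; rewrite leq_eqVlt => /orP[/eqP->//|kn].
by move: wn; rewrite inE; exact.
Qed.

Lemma killed_step_le (phi psi : R -> R) n :
  measurable_fun setT phi -> measurable_fun setT psi ->
  (forall y, 0 <= phi y) -> (forall y, b < y -> phi y = 0) ->
  (forall y, 0 <= psi y) ->
  (forall y, y <= b -> (density_mean X r phi y <= (psi y)%:E)%E) ->
  (killed phi n.+1 <= killed psi n)%E.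
Proof.
move=> mphi mpsi phi0 phib psi0 le; rewrite killedS//.
apply: ge0_le_integral => //.
- by move=> w _; exact: density_mean_ge0.
- exact/measurable_funTS/measurable_density_mean.
- exact: killed_measurable.
- by move=> w wn; rewrite le// wn.
Qed.

Lemma killed_step_ge (phi psi : R -> R) n :
  measurable_fun setT phi -> measurable_fun setT psi ->
  (forall y, 0 <= phi y) -> (forall y, b < y -> phi y = 0) ->
  (forall y, 0 <= psi y) ->
  (forall y, y <= b -> ((psi y)%:E <= density_mean X r phi y)%E) ->
  (killed psi n <= killed phi n.+1)%E.
Proof.
move=> mphi mpsi phi0 phib psi0 le; rewrite killedS//.
apply: ge0_le_integral => //.
- by move=> w _; rewrite lee_fin.
- exact: killed_measurable.
- exact/measurable_funTS/measurable_density_mean.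
- by move=> w wn; rewrite le// wn.
Qed.

(** Dynkin's inequality for the killed chain. Both terms on the left are used: the sum bounds the
    accumulated drift, the last term keeps the mean of [phi] bounded. *)
Lemma lyapunov (phi delta : R -> R) n :
  measurable_fun setT phi -> measurable_fun setT delta ->
  (forall y, 0 <= phi y) -> (forall y, b < y -> phi y = 0) ->
  (forall y, 0 <= delta y) ->
  (forall y, y <= b -> (density_mean X r phi y + (delta y)%:E <= (phi y)%:E)%E) ->
  (\sum_(0 <= k < n) killed delta k + killed phi n <= (phi x0)%:E)%E.
Proof.
move=> mphi mdelta phi0 phib delta0 le.
elim: n => [|n ih]; first by rewrite big_nil add0e killed0.
apply: le_trans ih; rewrite big_nat_recr//= -addeA leeD2l//.
rewrite killedS// /killed -ge0_integralD//.
- apply: ge0_le_integral => //.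
  + by move=> w _; rewrite adde_ge0 ?lee_fin//; exact: density_mean_ge0.
  + apply: emeasurable_funD; first exact: killed_measurable.
    exact/measurable_funTS/measurable_density_mean.
  + exact: killed_measurable.
  + by move=> w wn; rewrite addeC le// wn.
- by move=> w _; rewrite lee_fin.
- exact: killed_measurable.
- by move=> w _; exact: density_mean_ge0.
- exact/measurable_funTS/measurable_density_mean.
Qed.

Lemma hitting_timeE w :
  hitting_time S b w = (\sum_(0 <= n <oo) (\1_(below n) w)%:E)%E.
Proof.
have [[n bn]|nn] := pselect (exists n, b < S n w).
  have exn : exists n, b < S n w by exists n.
  case: (ex_minnP exn) => N bN minN.
  have belowN k : (\1_(below k) w : R) = (k < N)%N%:R.
    rewrite indicE; congr (_%:R); congr nat_of_bool; apply/idP/idP.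
      rewrite inE => wk; rewrite ltnNge; apply/negP => Nk.
      by move: bN; rewrite ltNge wk.
    move=> kN; rewrite inE => j jk; rewrite leNgt; apply/negP => /minN.
    by rewrite leqNgt (leq_ltn_trans jk).
  have -> : hitting_time S b w = N%:R%:E.
    apply/eqP; rewrite eq_le; apply/andP; split.
      by apply: ereal_inf_lbound; exists N.
    apply: le_ereal_inf_tmp => _ [m /= bm <-].
    by rewrite lee_fin ler_nat minN.
  rewrite (nneseries_split 0 N); last by move=> k _; rewrite lee_fin.
  rewrite eseries0; last first.
    by move=> k Nk _; rewrite belowN ltnNge; rewrite add0n in Nk; rewrite Nk.
  rewrite adde0 add0n sumEFin; congr EFin.
  rewrite big_nat (eq_bigr (fun=> 1)); last by move=> k /andP[_ kN]; rewrite belowN kN.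
  by rewrite -big_nat sumr_const_nat subn0.
have below1 k : (\1_(below k) w : R) = 1.
  rewrite indicE mem_set// => j jk; rewrite leNgt; apply/negP => bj.
  by apply: nn; exists j.
have -> : hitting_time S b w = +oo%E.
  rewrite /hitting_time (_ : [set _ | _ in _] = set0) ?ereal_inf0//.
  by apply/seteqP; split => // _ [m /= bm _]; apply: nn; exists m.
apply/esym/eqyP => A A0.
have [N AN] : exists N : nat, A <= N%:R.
  by exists (Num.truncn A).+1; rewrite ltW// truncnS_gt.
apply: (@le_trans _ _ (N%:R)%:E); first by rewrite lee_fin.
apply: le_trans (nneseries_lim_ge N _); last by move=> k _ _; rewrite lee_fin.
rewrite sumEFin (eq_bigr (fun=> 1)); last by move=> k _; rewrite below1.
by rewrite sumr_const_nat subn0.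
Qed.

Lemma mean_hitting_time :
  (\int[Q]_w hitting_time S b w = \sum_(0 <= n <oo) Q (below n))%E.
Proof.
under eq_integral do rewrite hitting_timeE.
rewrite integral_nneseries//.
- by apply: eq_eseriesr => n _; rewrite integral_indic// setIT.
- by move=> n; apply/measurable_EFinP; exact: measurable_indic.
Qed.

Lemma mean_hitting_time_le (phi : R -> R) (e : R) : 0 < e ->
  measurable_fun setT phi ->
  (forall y, 0 <= phi y) -> (forall y, b < y -> phi y = 0) ->
  (forall y, y <= b -> (density_mean X r phi y + e%:E <= (phi y)%:E)%E) ->
  (\int[Q]_w hitting_time S b w <= (phi x0 / e)%:E)%E.
Proof.
move=> e0 mphi phi0 phib le; rewrite mean_hitting_time.
apply: lime_le; first by apply: is_cvg_nneseries => n _ _; exact: measure_ge0.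
apply: nearW => n.
rewrite EFinM lee_pdivlMr// muleC.
have := lyapunov n mphi (@measurable_cst _ _ _ _ setT e) phi0 phib (fun=> ltW e0) le.
apply: le_trans; rewrite ge0_sume_distrr; last by move=> k _; exact: measure_ge0.
under [X in (_ <= X + _)%E]eq_bigr do rewrite killed_cst.
by rewrite leeDl// killed_ge0.
Qed.

(** If survival had probability [p > 0], then at every time most of that mass would sit where
    [phi < M], because the mean of [phi] stays below [phi x0]; there [delta >= e], so the
    accumulated drift would exceed [phi x0]. *)
Lemma hitting_time_lty_ae (phi delta : R -> R) :
  measurable_fun setT phi -> measurable_fun setT delta ->
  (forall y, 0 <= phi y) -> (forall y, b < y -> phi y = 0) ->
  (forall y, 0 <= delta y) ->
  (forall y, y <= b -> (density_mean X r phi y + (delta y)%:E <= (phi y)%:E)%E) ->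
  (forall M, exists2 e, 0 < e & forall y, y <= b -> phi y < M -> e <= delta y) ->
  Q [set w | (hitting_time S b w < +oo)%E] = 1%E.
Proof.
move=> mphi mdelta phi0 phib delta0 le coercive.
pose F := \bigcap_n below n.
have mF : measurable F by apply: bigcap_measurable.
have -> : [set w | (hitting_time S b w < +oo)%E] = ~` F.
  apply/seteqP; split => w /=.
    move=> h Fw; move: h; rewrite /hitting_time (_ : [set _ | _ in _] = set0).
      by rewrite ereal_inf0 ltxx.
    apply/seteqP; split => // _ [m /= bm _].
    by move: bm; rewrite ltNge (Fw m).
  move=> nF; have [k bk] : exists k, b < S k w.
    apply: contrapT => nk; apply: nF => n _ k _; rewrite leNgt.
    by apply/negP => bk; apply: nk; exists k.
  by apply: (@le_lt_trans _ _ k%:R%:E); [apply: ereal_inf_lbound; exists k|exact: ltey].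
rewrite probability_setC//.
suff -> : Q F = 0%E by rewrite sube0.
apply/eqP; rewrite eq_le measure_ge0 andbT leNgt; apply/negP => QF0.
have QFfin : Q F \is a fin_num by exact: fin_num_measure.
pose p := fine (Q F).
have p0 : 0 < p by rewrite -lte_fin /p fineK.
have [M [M0 Mp]] : exists M, 0 < M /\ M * p = 2 * (phi x0 + 1).
  exists (2 * (phi x0 + 1) / p); rewrite divfK ?gt_eqF//; split => //.
  by rewrite divr_gt0// mulr_gt0//; have := phi0 x0; lra.
have [e e0 he] := coercive M.
(* Pointwise [M * e <= e * phi + M * delta], since [phi >= M] or [delta >= e]. *)
have key k : ((M * e * p)%:E <= (e * phi x0)%:E + M%:E * killed delta k)%E.
  apply: (@le_trans _ _ (killed (fun=> (M * e)) k)).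
    rewrite killed_cst EFinM /p fineK//; apply: lee_wpmul2l.
      by rewrite lee_fin mulr_ge0// ltW.
    by apply: le_measure; rewrite ?inE// => w; exact.
  apply: (@le_trans _ _ (killed (fun y => e * phi y + M * delta y) k)).
    apply: killed_le => //.
    - by apply: measurable_funD; apply: measurable_funM.
    - by move=> y; rewrite mulr_ge0// ltW.
    - move=> y yb; have := he y yb; have := phi0 y; have := delta0 y.
      by case: (ltP (phi y) M) => h; [move=> ? ? /(_ isT); nra|nra].
  rewrite killedD//; [|exact: measurable_funM|exact: measurable_funM
    |by move=> y; rewrite mulr_ge0// ltW|by move=> y; rewrite mulr_ge0// ltW].
  rewrite !killedZ ?(ltW e0) ?(ltW M0)//; apply: leeD => //.
  rewrite EFinM; apply: lee_wpmul2l; first by rewrite lee_fin ltW.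
  have := lyapunov k mphi mdelta phi0 phib delta0 le.
  apply: le_trans; rewrite leeDr// sume_ge0// => j _; exact: killed_ge0.
have sum N : N%:R * (M * e * p) <= N%:R * (e * phi x0) + M * phi x0.
  rewrite -lee_fin.
  have := lyapunov N mphi mdelta phi0 phib delta0 le.
  have : (\sum_(0 <= k < N) (M * e * p)%:E <=
      \sum_(0 <= k < N) ((e * phi x0)%:E + M%:E * killed delta k))%E.
    by apply: lee_sum => k _; exact: key.
  rewrite big_split/= !sumEFin !sumr_const_nat subn0.
  rewrite -(mulr_natl (M * e * p)) -(mulr_natl (e * phi x0)).
  rewrite -ge0_sume_distrr; last by move=> k _; exact: killed_ge0.
  move=> h1 h2; apply: (le_trans h1); rewrite EFinD leeD2l// EFinM.
  apply: lee_wpmul2l; first by rewrite lee_fin ltW.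
  apply: le_trans h2.
  by rewrite leeDl// killed_ge0.
have f0 := phi0 x0.
pose N := (Num.truncn (M * phi x0 / e)).+1.
have hN : M * phi x0 < N%:R * e.
  by rewrite -ltr_pdivrMr// truncnS_gt.
have Mep : M * e * p = 2 * (phi x0 + 1) * e by rewrite -Mp; ring.
have N1 : 0 < N%:R * e by rewrite mulr_gt0.
have N2 := mulr_ge0 (ltW N1) f0.
by have := sum N; rewrite Mep; lra.
Qed.
Let ereal_cvg0_lt (u : nat -> \bar R) (e : R) : 0 < e ->
  u n @[n --> \oo] --> 0%E -> exists N, forall n, (N <= n)%N -> (u n < e%:E)%E.
Proof.
move=> e0 /fine_cvgP[ufin /(cvgr_lt _)/(_ e e0) ue].
have [N _ hN] := filterI ufin ue.
by exists N => n /hN [fn un]; rewrite -(fineK fn) lte_fin.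
Qed.

(** [B = 0] gives the submartingale; [B > 0] keeps only its large values, with
    [depth 0 <= depth B + B]. *)
Definition depth (B y : R) : R := Num.max (b - B - y) 0.

(** If the survival probabilities were summable, the killed mean of [depth 0] at a late time [N]
    would be at most the mean of [depth B] at time [m], plus [K] times their sum from [m] on, plus
    [B * Q (below N)]. Choosing [m], then [B], then [N] makes each term at most [c / 4], against the
    lower bound [c]. *)
Lemma mean_hitting_time_infinite (K : R) : 0 <= K ->
  (forall B y : R, 0 <= B -> y <= b ->
    (density_mean X r (depth B) y <= (depth B y + K)%:E)%E) ->
  (forall y, y <= b -> ((depth 0 y)%:E <= density_mean X r (depth 0) y)%E) ->
  ((depth 0 x0)%:E < density_mean X r (depth 0) x0)%E ->
  (\int[Q]_w hitting_time S b w = +oo)%E.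
Proof.
move=> K0 up down start; rewrite mean_hitting_time.
have Q_ge0 n : (0 <= Q (below n))%E by exact: measure_ge0.
apply/eqP; rewrite -leye_eq leNgt; apply/negP => fin.
have mdepth B : measurable_fun setT (depth B).
  by apply: measurable_maxr; meas_tac.
have depth0 B y : 0 <= depth B y by rewrite le_max lexx orbT.
have depthb B y : 0 <= B -> b < y -> depth B y = 0.
  by move=> B0 yb; apply/max_idPr; lra.
(* [depth 0 x0] may be 0, so positivity comes from the strict first step. *)
have [c c0 cE] : exists2 c : R, 0 < c & (c%:E <= density_mean X r (depth 0) x0)%E.
  have pos : (0 < density_mean X r (depth 0) x0)%E.
    by apply: le_lt_trans start; rewrite lee_fin.
  have fin0 : density_mean X r (depth 0) x0 \is a fin_num.
    rewrite ge0_fin_numE; last exact: ltW.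
    by apply: le_lt_trans (up 0 x0 (lexx 0) x0b) _; rewrite ltry.
  by exists (fine (density_mean X r (depth 0) x0)); rewrite -?lte_fin fineK.
have c_le n : (c%:E <= killed (depth 0) n.+1)%E.
  elim: n => [|n ih].
    (* The bound [c] is known at the state [x0] only, hence the indicator. *)
    apply: (@le_trans _ _ (killed (fun y => c * \1_[set x0] y) 0)).
      rewrite killed0//.
      - by rewrite indicE mem_set// mulr1.
      - by apply: measurable_funM => //; exact: measurable_indic.
      - by move=> y; rewrite mulr_ge0// ltW.
    apply: killed_step_ge => //.
    - by apply: measurable_funM => //; exact: measurable_indic.
    - by move=> y; exact: depthb.
    - by move=> y; rewrite mulr_ge0// ltW.
    - move=> y yb; rewrite indicE; case: (boolP (y \in [set x0])) => [|_].
        by rewrite inE => ->; rewrite mulr1.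
      by rewrite mulr0; exact: density_mean_ge0.
  apply: (le_trans ih); apply: killed_step_ge => //.
  - by move=> y; exact: depthb.
have grow B n : 0 <= B ->
    (killed (depth B) n.+1 <= killed (depth B) n + K%:E * Q (below n))%E.
  move=> B0; rewrite -killed_cst -killedD//; apply: killed_step_le => //.
  - exact: measurable_funD.
  - by move=> y; exact: depthb.
  - by move=> y; rewrite addr_ge0.
  - by move=> y yb; exact: up.
have growth B m j : 0 <= B -> (killed (depth B) (m + j)%N <=
    killed (depth B) m + K%:E * \sum_(m <= k < m + j) Q (below k))%E.
  move=> B0; elim: j => [|j ih]; first by rewrite addn0 big_geq// mule0 adde0.
  rewrite addnS; apply: (le_trans (grow _ _ B0)).
  rewrite big_nat_recr/= ?leq_addr// ge0_muleDr ?sume_ge0// addeA.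
  by rewrite leeD2r.
have tail0 := nneseries_tail_cvg fin (fun k _ => Q_ge0 k).
have c4 : 0 < c / 4 by rewrite divr_gt0.
have cK : 0 < c / 4 / (K + 1) by rewrite divr_gt0//; lra.
have [m hm] := ereal_cvg0_lt cK tail0.
have tail_ge j : (\sum_(m <= k < m + j) Q (below k) <= (c / 4 / (K + 1))%:E)%E.
  apply: (le_trans (nneseries_lim_ge _ _)) => //.
  by apply/ltW/hm.
have fin_m : (killed (depth 0) m < +oo)%E.
  have : forall j, (killed (depth 0) j < +oo)%E.
    elim => [|j ih]; first by rewrite killed0// ltry.
    apply: (le_lt_trans (grow _ _ (lexx 0))); apply: lte_add_pinfty => //.
    by rewrite lte_mul_pinfty// (le_lt_trans (probability_le1 _ _))// ltry.
  exact.
have [B B0 hB] : exists2 B : R, 0 <= B & (killed (depth B) m < (c / 4)%:E)%E.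
  have := @dominated_convergence _ _ R Q (below m) (measurable_below m)
    (fun (n : nat) w => (depth n%:R (S m w))%:E) (cst 0%E)
    (fun w => (depth 0 (S m w))%:E).
  case=> //.
  - by move=> n; exact: killed_measurable.
  - apply: aeW => w _; apply: cvg_near_cst; near=> n.
    rewrite /= /depth max_r// subr_le0 lerBlDr -lerBlDl.
    by near: n; exact: nbhs_infty_ger.
  - apply/integrableP; split; first exact: killed_measurable.
    move: fin_m; congr (_ < _)%E; apply: eq_integral => w _ /=.
    by rewrite ger0_norm.
  - apply: aeW => w n _; rewrite /= lee_fin ger0_norm// /depth.
    rewrite ge_max !le_max lexx orbT andbT; apply/orP; left.
    by rewrite subr0 lerB// lerBlDr lerDl.
  move=> _ _; rewrite integral0 => /(ereal_cvg0_lt c4)[N hN].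
  by exists N%:R => //; exact: hN.
have cB : 0 < c / 4 / (B + 1) by rewrite divr_gt0//; lra.
have [n hn] := ereal_cvg0_lt cB tail0.
pose N := (m + n.+1)%N.
have QN : (Q (below N) <= (c / 4 / (B + 1))%:E)%E.
  have nN : (n <= N)%N by rewrite /N addnS ltnW// ltnS leq_addl.
  apply: (le_trans _ (ltW (hn _ nN))).
  apply: le_trans (nneseries_lim_ge N.+1 _) => //.
  by rewrite big_nat1.
have final : (c%:E <= (c / 4)%:E + K%:E * (c / 4 / (K + 1))%:E +
    B%:E * (c / 4 / (B + 1))%:E)%E.
  have cN : (c%:E <= killed (depth 0) N)%E by rewrite /N addnS; exact: c_le.
  apply: (le_trans cN); apply: (@le_trans _ _ (killed (fun y => depth B y + B) N)).
    apply: killed_le => //; first exact: measurable_funD.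
    move=> y _; rewrite /depth.
    by case: (leP (b - 0 - y) 0); case: (leP (b - B - y) 0); lra.
  rewrite killedD// killed_cst; apply: leeD; last first.
    by apply: lee_wpmul2l => //; rewrite lee_fin.
  apply: (le_trans (growth _ _ _ B0)); apply: leeD; first exact: ltW.
  by apply: lee_wpmul2l => //; rewrite lee_fin.
move: final; rewrite -!EFinM -!EFinD lee_fin.
have e1 : K * (c / 4 / (K + 1)) <= c / 4.
  rewrite mulrA ler_pdivrMr; last by lra.
  by nra.
have e2 : B * (c / 4 / (B + 1)) <= c / 4.
  rewrite mulrA ler_pdivrMr; last by lra.
  by nra.
by lra.
Unshelve. all: by end_near. Qed.

End hitting.

(** * The Blanchet-Glynn kernel *)

Lemma near_pinfty_ex (R : realType) (p : R -> Prop) :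
  (\forall x \near +oo, p x) -> exists M : R, forall x, M <= x -> p x.
Proof.
move=> [M [_ hM]]; exists (M + 1) => x Mx; apply: hM.
by rewrite (lt_le_trans _ Mx)// ltrDl.
Qed.

Section blanchet_glynn.
Context d (T : measurableType d) (R : realType).
Variables (P : probability T R) (X : {RV P >-> R}).
Hypothesis EX_fin : ('E_P[(fun w => `|X w|)%R] < +oo)%E.
Hypothesis EX_lt0 : ('E_P[X] < 0)%E.
Variable alpha : R.
Hypothesis alpha_gt1 : 1 < alpha.
Hypothesis tail_rv : right_tail_varies_regularly P X alpha.

Let nu : probability R R := distribution P X.
Let mu := `|fine 'E_P[X]|.

Let nu_int : nu.-integrable setT (EFin \o @idfun R).
Proof.
apply/integrableP; split; first by apply/measurable_EFinP; exact: measurable_id.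
rewrite [ltLHS](_ : _ = 'E_P[(fun w => `|X w|)%R])%E//.
rewrite unlock; rewrite ge0_integral_distribution//.
exact/measurable_EFinP.
Qed.

Let X_int : P.-integrable setT (EFin \o X).
Proof.
apply/integrableP; split; first by apply/measurable_EFinP; exact: measurable_funPT.
by move: EX_fin; rewrite unlock.
Qed.

Let EX_fine : ('E_P[X] = (fine 'E_P[X])%:E)%E.
Proof.
rewrite fineK//; rewrite unlock.
exact: integrable_fin_num.
Qed.

Let mu_gt0 : 0 < mu.
Proof. by rewrite normr_gt0 lt_eqF// -lte_fin -EX_fine. Qed.

Let mean_mu : \int[nu]_x x = - mu.
Proof.
rewrite /mu ltr0_norm ?opprK; last by rewrite -lte_fin -EX_fine.
rewrite /Rintegral integral_distribution//; first by rewrite unlock.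
Qed.

Let upper_tailE : upper_tail P X = tail nu.
Proof.
apply/funext => t; rewrite /upper_tail /tail /Rintegral; congr fine.
rewrite ge0_integral_distribution//.
- rewrite -[in LHS](setIT [set w | t < X w]) -integral_indic//.
    apply: eq_integral => w _ /=; rewrite indicE; congr (_%:R%:E).
    by congr nat_of_bool; apply/idP/idP; rewrite inE.
  rewrite (_ : [set _ | _] = X @^-1` `]t, +oo[%classic).
    exact: measurable_funPTI.
  by apply/seteqP; split => w /=; rewrite in_itv/= andbT.
- by apply/measurable_EFinP; apply: measurable_bool_nat; meas_tac.
Qed.

Let nu_rv : regularly_varying_tail (tail nu) alpha.
Proof. by rewrite -upper_tailE. Qed.

Let bg_vE x : bg_v P X x = weight nu mu (- x).
Proof.
rewrite /bg_v /weight; congr (Num.min 1 (_ * _)).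
by rewrite upper_tailE /Rintegral -(excess_integral nu_int).
Qed.

Let measurable_g (x : R) : measurable_fun setT (fun z : R => weight nu mu (x - z)).
Proof. exact: (measurable_weightB nu_int mu_gt0). Qed.

Let affine_g (x : R) : affine_bounded (fun z : R => weight nu mu (x - z)).
Proof.
have -> : (fun z : R => weight nu mu (x - z)) = (fun z => 1 * weight nu mu (x - z)).
  by apply/funext => z; rewrite mul1r.
exact: (affine_bounded_weight nu_int nu_rv mu_gt0 x (affine_bounded_cst 1)).
Qed.

Let g_ge0 x : 0 <= weight nu mu x.
Proof. exact: ltW (weight_gt0 nu_int nu_rv mu_gt0 x). Qed.

Let bg_wE x : bg_w P X x = \int[nu]_z weight nu mu (- x - z).
Proof.
rewrite /bg_w unlock /Rintegral; congr fine.
rewrite ge0_integral_distribution//.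
- by apply: eq_integral => w _ /=; rewrite bg_vE opprD.
- exact/measurable_EFinP.
- by move=> y; rewrite lee_fin.
Qed.

Let bg_w_gt0 x : 0 < bg_w P X x.
Proof. by rewrite bg_wE; exact: (mean_weight_gt0 nu_int nu_rv mu_gt0). Qed.

Let bg_v_measurable : measurable_fun setT (bg_v P X).
Proof.
have -> : bg_v P X = (fun x => weight nu mu (0 - x)).
  by apply/funext => x; rewrite bg_vE sub0r.
exact: measurable_g.
Qed.

Let bg_wV_measurable : measurable_fun setT (fun x => (bg_w P X x)^-1).
Proof.
have -> : (fun x => (bg_w P X x)^-1) = (fun x => - - (bg_w P X x)^-1).
  by apply/funext => x; rewrite opprK.
apply: measurableT_comp => //; apply: nondecreasing_measurable => // x y xy.
rewrite lerN2 lef_pV2 ?posrE// !bg_wE.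
apply: mean_le => //; [exact: affine_g..|] => z.
by apply: (weight_le nu_int mu_gt0); lra.
Qed.

Section kernel.
Variables b c : R.

Let r (y z : R) : R := bg_v P X (z - b - c) / bg_w P X (y - b - c).

Let mr : measurable_fun setT (fun p : R * R => r p.1 p.2).
Proof.
apply: measurable_funM.
  apply: measurableT_comp => //; do 2 apply: measurable_funB => //.
apply: (measurableT_comp bg_wV_measurable).
by do 2 apply: measurable_funB => //.
Qed.

Let r_ge0 y z : 0 <= r y z.
Proof. by rewrite divr_ge0 ?bg_vE// ltW. Qed.

(** The weight sees [y], [b] and [c] only through [b + c - y], which links the chain to the drift
    lemmas. *)
Lemma density_mean_bg (phi F : R -> R) (y : R) :
  affine_bounded F -> (forall z, 0 <= phi z) -> (forall z, phi (y + z) = F z) ->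
  (density_mean X r phi y)%E =
  ((\int[nu]_z (F z * weight nu mu (b + c - y - z))) /
   \int[nu]_z weight nu mu (b + c - y - z))%:E.
Proof.
move=> aF phi0 phiF.
have aFg := affine_bounded_weight nu_int nu_rv mu_gt0 (b + c - y) aF.
have xE : - (y - b - c) = b + c - y by ring.
have W0 := mean_weight_gt0 nu_int nu_rv mu_gt0 (b + c - y).
rewrite mulrC -meanZ// /Rintegral fineK; last first.
  by apply: integrable_fin_num => //; apply: integrable_affine_bounded => //;
    exact: affine_boundedZ.
rewrite ge0_integral_distribution//.
- apply: eq_integral => w _ /=; rewrite phiF /r bg_vE bg_wE xE mulrA mulrC.
  have -> : - (y + X w - b - c) = b + c - y - X w by ring.
  by rewrite mulrA.
- apply/measurable_EFinP.
  by case: (affine_boundedZ (\int[nu]_z weight nu mu (b + c - y - z))^-1 aFg).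
- move=> z; rewrite lee_fin !mulr_ge0//; last by rewrite -phiF.
  by rewrite invr_ge0 ltW.
Qed.


Section chain.
Context d' (Om : measurableType d') (S : nat -> {mfun Om >-> R}) (Q : probability Om R).
Hypothesis b_ge0 : 0 <= b.
Hypothesis SQ : markov_chain Q S 0 (bg_kernel P X b c).

Let W_gt0 y : 0 < \int[nu]_z weight nu mu (b + c - y - z).
Proof. exact: (mean_weight_gt0 nu_int nu_rv mu_gt0). Qed.

Let measurable_below_b : measurable_fun setT (fun y : R => (y <= b)%R).
Proof. by apply: measurable_fun_ler; meas_tac. Qed.

Lemma bg_mean_hitting_time_le (e : R) : 0 < e -> 0 <= c ->
  (forall x, c <= x ->
    \int[nu]_z ((x - z) * (c <= x - z)%R%:R * weight nu mu (x - z)) <=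
      (x - e) * \int[nu]_z weight nu mu (x - z)) ->
  (\int[Q]_w hitting_time S b w <= ((b + c) / e)%:E)%E.
Proof.
move=> e0 c0 drift.
pose phi (y : R) := (b + c - y) * (y <= b)%R%:R.
have phi0 y : 0 <= phi y.
  by rewrite /phi; case: (leP y b) => yb; rewrite ?mulr1 ?mulr0//; lra.
have := @mean_hitting_time_le _ _ _ _ _ P X Q S r mr r_ge0 0 SQ b b_ge0 phi e e0.
rewrite /phi b_ge0 subr0 mulr1; apply => //.
- by apply: measurable_funM; [meas_tac|exact: measurable_bool_nat].
- by move=> y yb; rewrite leNgt yb mulr0.
move=> y yb.
rewrite (@density_mean_bg _ (fun z => (b + c - y - z) * (c <= b + c - y - z)%R%:R)) //.
- rewrite yb mulr1 -EFinD lee_fin -lerBrDr ler_pdivrMr; last exact: W_gt0.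
  by apply: drift; lra.
- by affine_tac.
- by move=> z; congr (_ * (nat_of_bool _)%:R); [ring|apply/idP/idP; lra].
Qed.

Lemma bg_hitting_time_lty : 1 <= c ->
  (forall x, c <= x ->
    \int[nu]_z (ln (x - z) * (c <= x - z)%R%:R * weight nu mu (x - z)) <=
      (ln x - x^-1) * \int[nu]_z weight nu mu (x - z)) ->
  Q [set w | (hitting_time S b w < +oo)%E] = 1%E.
Proof.
move=> c1 drift.
pose phi (y : R) := ln (b + c - y) * (y <= b)%R%:R.
have mphi : measurable_fun setT phi.
  apply: measurable_funM; last exact: measurable_bool_nat.
  by apply: measurableT_comp; [exact: measurable_ln|meas_tac].
have phi0 y : 0 <= phi y.
  rewrite /phi; case: (leP y b) => yb; rewrite ?mulr1 ?mulr0//.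
  by apply: ln_ge0; lra.
(* For [y <= b] this is the inverse distance, the drift in [drift_ln]; written through [phi], it is
   visibly bounded below where [phi] is bounded. *)
pose delta (y : R) := expR (- phi y).
apply: (@hitting_time_lty_ae _ _ _ _ _ P X Q S r mr r_ge0 0 SQ b b_ge0 phi delta) => //.
- by apply: measurableT_comp; [exact: measurable_expR|exact: measurableT_comp].
- by move=> y yb; rewrite /phi leNgt yb mulr0.
- by move=> y; exact: expR_ge0.
- move=> y yb.
  rewrite (@density_mean_bg phi
    (fun z => ln (b + c - y - z) * (c <= b + c - y - z)%R%:R)) //.
  + rewrite /delta /phi yb mulr1 expRN lnK ?posrE; last by lra.
    rewrite -EFinD lee_fin -lerBrDr ler_pdivrMr; last exact: W_gt0.
    by apply: drift; lra.
  + exact: affine_bounded_ln.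
  + move=> z; rewrite /phi; congr (ln _ * (nat_of_bool _)%:R); first by ring.
    by apply/idP/idP; lra.
- move=> M; exists (expR (- M)); first exact: expR_gt0.
  by move=> y _ yM; rewrite ler_expR lerN2 ltW.
Qed.

Lemma bg_mean_hitting_time_infinite (K : R) : 0 <= K -> 0 <= c ->
  (forall a x, \int[nu]_z (Num.max (a - z) 0 * weight nu mu (x - z)) <=
    (Num.max a 0 + K) * \int[nu]_z weight nu mu (x - z)) ->
  (forall x, c <= x -> (x - c) * \int[nu]_z weight nu mu (x - z) <
    \int[nu]_z (Num.max (x - c - z) 0 * weight nu mu (x - z))) ->
  (\int[Q]_w hitting_time S b w = +oo)%E.
Proof.
move=> K0 c0 up down.
have depth0 B y : 0 <= depth b B y by rewrite le_max lexx orbT.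
have depth_mean B y := @density_mean_bg (depth b B)
  (fun z => Num.max (b - B - y - z) 0) y _ (depth0 B) _.
have aff B y : affine_bounded (fun z : R => Num.max (b - B - y - z) 0) by affine_tac.
have dE B y z : depth b B (y + z) = Num.max (b - B - y - z) 0.
  by rewrite /depth opprD addrA.
have depth_lt y : y <= b ->
    ((depth b 0 y)%:E < density_mean X r (depth b 0) y)%E.
  move=> yb; rewrite depth_mean// lte_fin ltr_pdivlMr; last exact: W_gt0.
  rewrite /depth subr0 max_l ?subr_ge0//.
  have := down (b + c - y); rewrite (_ : b + c - y - c = b - y); last by ring.
  by apply; lra.
apply: (@mean_hitting_time_infinite _ _ _ _ _ P X Q S r mr r_ge0 0 SQ b b_ge0 K) => //.
- move=> B y B0 yb; rewrite depth_mean// lee_fin ler_pdivrMr; last exact: W_gt0.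
  by have := up (b - B - y) (b + c - y).
- by move=> y yb; exact/ltW/depth_lt.
- exact: depth_lt.
Qed.

End chain.
End kernel.

(** Before hitting, the distance is at least [c], so eventual drift bounds hold at every visited
    state once [c >= c0]. The bound [1 <= c0] keeps the logarithm nonnegative. *)
Lemma bg_drift_threshold : exists c0 : R, [/\ 1 <= c0,
  2 < alpha -> exists2 e : R, 0 < e & forall c x, c0 <= c <= x ->
    \int[nu]_z ((x - z) * (c <= x - z)%R%:R * weight nu mu (x - z)) <=
      (x - e) * \int[nu]_z weight nu mu (x - z),
  forall c x, c0 <= c <= x ->
    \int[nu]_z (ln (x - z) * (c <= x - z)%R%:R * weight nu mu (x - z)) <=
      (ln x - x^-1) * \int[nu]_z weight nu mu (x - z) &
  alpha < 3 / 2 -> forall c x, c0 <= c <= x ->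
    (x - c) * \int[nu]_z weight nu mu (x - z) <
    \int[nu]_z (Num.max (x - c - z) 0 * weight nu mu (x - z))].
Proof.
have [c1 h1] := near_pinfty_ex (drift_ln nu_int alpha_gt1 nu_rv mu_gt0 mean_mu).
have [c2 h2] : exists c2, 2 < alpha -> exists2 e : R, 0 < e & forall c x,
    0 <= c -> c2 <= x -> c <= x ->
    \int[nu]_z ((x - z) * (c <= x - z)%R%:R * weight nu mu (x - z)) <=
      (x - e) * \int[nu]_z weight nu mu (x - z).
  have [a2|] := ltP 2 alpha; last by exists 0.
  have [e e0 /near_pinfty_ex[c2 h2]] := drift_id nu_int alpha_gt1 nu_rv mu_gt0 mean_mu a2.
  by exists c2 => _; exists e => // c x c0 cx2 cx; apply: h2; rewrite ?c0.
have [c3 h3] : exists c3, alpha < 3 / 2 -> forall c x,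
    0 <= c -> c3 <= x -> c <= x ->
    (x - c) * \int[nu]_z weight nu mu (x - z) <
    \int[nu]_z (Num.max (x - c - z) 0 * weight nu mu (x - z)).
  have [a32|] := ltP alpha (3 / 2); last by exists 0.
  have [c3 h3] := near_pinfty_ex
    (drift_excess_gt nu_int alpha_gt1 nu_rv mu_gt0 mean_mu a32).
  by exists c3 => _ c x c0 cx3 cx; apply: h3; rewrite ?c0.
pose c0 := Num.max 1 (Num.max c1 (Num.max c2 c3)).
have [e1 e2] : 1 <= c0 /\ c1 <= c0 by rewrite !le_max !lexx !orbT.
have [e3 e4] : c2 <= c0 /\ c3 <= c0 by rewrite !le_max !lexx !orbT.
exists c0; split=> //.
- move=> /h2[e e0 he]; exists e => // c x /andP[cc cx].
  by apply: he => //; lra.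
- by move=> c x /andP[cc cx]; apply: h1; [|apply/andP; split]; lra.
- by move=> /h3 h c x /andP[cc cx]; apply: h; lra.
Qed.

Lemma bg_excess_bound : exists2 K : R, 0 <= K & forall a x,
  \int[nu]_z (Num.max (a - z) 0 * weight nu mu (x - z)) <=
    (Num.max a 0 + K) * \int[nu]_z weight nu mu (x - z).
Proof. exact: (drift_excess_le nu_int nu_rv mu_gt0). Qed.

End blanchet_glynn.

Theorem proposition2 (R : realType) (d : measure_display)
    (T : measurableType d) (P : probability T R) (X : {RV P >-> R})
    (alpha : R) (alpha_gt1 : 1 < alpha)
    (EX_fin : ('E_P[(fun w => `|X w|)%R] < +oo)%E)
    (EX_lt0 : ('E_P[X] < 0)%E)
    (A1 : right_tail_varies_regularly P X alpha)
    (A2 : left_tail_negligible P X)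
    (A3 : density_varies_regularly P X alpha) :
  exists c0 : R, forall c : R, c0 <= c ->
  forall (d' : measure_display) (Om : measurableType d')
    (S : nat -> {mfun Om >-> R}) (Q : R -> probability Om R),
    (forall b : R, 0 <= b ->
       markov_chain (Q b) S 0 (bg_kernel P X b c)) ->
    [/\ 1 < alpha -> forall b : R, 0 <= b ->
          Q b [set w | (hitting_time S b w < +oo)%E] = 1%E,
        1 < alpha < 3 / 2 -> forall b : R, 0 <= b ->
          (\int[Q b]_w hitting_time S b w)%E = +oo%E &
        2 < alpha -> exists K : R, \forall b \near +oo,
          (\int[Q b]_w hitting_time S b w <= (K * b)%:E)%E].
Proof.
have [c0 [c01 h1 h2 h3]] := bg_drift_threshold EX_fin EX_lt0 alpha_gt1 A1.
have [K K0 hK] := bg_excess_bound EX_fin EX_lt0 A1.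
exists c0 => c cc0 d' Om S Q SQ.
have c1 : 1 <= c by exact: le_trans cc0.
have c_ge0 : 0 <= c by exact: le_trans c1.
split.
- move=> _ b b0; apply: (bg_hitting_time_lty EX_fin EX_lt0 A1 b0 (SQ b b0)) => // x cx.
  by apply: h2; rewrite cc0.
- move=> /andP[_ a32] b b0.
  apply: (bg_mean_hitting_time_infinite EX_fin EX_lt0 A1 b0 (SQ b b0) K0) => // x cx.
  by apply: h3; rewrite ?cc0.
(* For [b >= 1] one has [b + c <= (1 + c) * b]. *)
- move=> /h1[e e0 he]; exists ((1 + c) / e); near=> b.
  have b1 : 1 <= b by near: b; apply: nbhs_pinfty_ge; exact: num_real.
  have b0 : 0 <= b by lra.
  apply: le_trans (bg_mean_hitting_time_le EX_fin EX_lt0 A1 b0 (SQ b b0) e0 c_ge0 _) _.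
    by move=> x cx; apply: he; rewrite cc0.
  rewrite lee_fin mulrAC ler_wpM2r ?invr_ge0 ?(ltW e0)//.
  by have := ler_wpM2l c_ge0 b1; lra.
Unshelve. all: by end_near. Qed.
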